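(* Let $\beta\equiv\beta^{(4)}$ be a normalized nc sequence with a moment matrix $\mathcal M_2$ of rank 6 satisfying the column relation $\mathbb X\mathbb Y+\mathbb Y\mathbb X=\mathbf 0$. Then $\beta$ admits a nc measure if and only if $\mathcal M_2$ is positive semidefinite and one of the following is true: (1) $\beta_X=\beta_Y=\beta_{X^3}=\beta_{Y^3}=0$. In this case there exists a nc measure of type $(2,1)$ or $(3,1)$. (2) There exist $a_1>0$ and $a_3>0$ such that $$M:=\mathcal M_2-\xi\,\mathcal M_2^{(X,Y)}$$ is a positive semidefinite cm moment matrix satisfying $\mathrm{rank}\,M\le\mathrm{card}\,\mathcal V_M$, where $$X=\begin{pmatrix}\sqrt{a_1}&0\\0&-\sqrt{a_1}\end{pmatrix},\qquad Y=\begin{pmatrix}0&\sqrt{a_3}\\\sqrt{a_3}&0\end{pmatrix},$$ and $\xi>0$ is the smallest positive number such that the rank of $\mathcal M_2-\xi\mathcal M_2^{(X,Y)}$ is smaller than the rank of $\mathcal M_2$.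
   Context: Words are elements of the free monoid on noncommuting letters $X,Y$; $|w|$ is the length of $w$, $w^*$ its reverse, and $v,w$ are cyclically equivalent if $v$ is a cyclic permutation of $w$. A sequence $\beta\equiv\beta^{(4)}=(\beta_w)_{|w|\le4}$ is a family of real numbers with $\beta_v=\beta_w$ for cyclically equivalent $v,w$ and $\beta_w=\beta_{w^*}$. It is normalized if $\beta_1=1$, a nc sequence if $\beta_{X^2Y^2}\ne\beta_{XYXY}$, and a cm sequence if $\beta_{X^2Y^2}=\beta_{XYXY}$. Its moment matrix $\mathcal M_2$ is the symmetric $7\times7$ matrix with rows and columns indexed by $1,X,Y,X^2,XY,YX,Y^2$ and $(U,V)$ entry $\beta_{U^*V}$; the column indexed by $w$ is denoted $w(\mathbb X,\mathbb Y)$, and ''satisfies a relation'' means that the corresponding linear relation between columns holds. A cm moment matrix is the moment matrix of a (not necessarily normalized) cm sequence. For a pair $(X,Y)$ of real symmetric $t\times t$ matrices, $\mathcal M_2^{(X,Y)}$ is the moment matrix of the sequence $\beta_w=\mathrm{Tr}(w(X,Y))$, where $\mathrm{Tr}(A)=\frac1t\mathrm{tr}(A)$. For a cm moment matrix $M$, the variety associated to $M$ is $\mathcal V_M=\bigcap\{(x,y)\in\mathbb R^2: g(x,y)=0\}$, the intersection over all $g\in\mathbb R[x,y]$ of degree $\le2$ such that $g(\mathbb X,\mathbb Y)=\mathbf 0$ in the column space of $M$ (for $g=\sum a_{ij}x^iy^j$, $g(\mathbb X,\mathbb Y)=\sum a_{ij}\mathbb X^i\mathbb Y^j$). A representing measure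 for $\beta$ consists of finitely many pairs $(A_i,B_i)$ (atoms) of real symmetric $t_i\times t_i$ matrices ($t_i$ is the size) and numbers $\lambda_i>0$ with $\sum_i\lambda_i=1$ and $\beta_w=\sum_i\lambda_i\mathrm{Tr}(w(A_i,B_i))$ for all $|w|\le4$. It is of type $(m_1,\dots,m_r)$ if it has exactly $m_i$ atoms of size $i$ and $m_r\neq0$. It is minimal if no other representing measure has smaller type, where types are compared first by $r$, then by $m_r$, then $m_{r-1}$, ..., then $m_1$. $\beta$ admits a nc measure if it has a minimal representing measure of type $(m_1,\dots,m_r)$ with $r>1$; for a nc sequence $\beta$, any representing measure is called a nc measure. *)

(* Defs.v *)
From mathcomp Require Import all_boot all_order all_algebra.
From mathcomp Require Import boolp classical_sets functions cardinality reals.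

Set Implicit Arguments.
Unset Strict Implicit.
Unset Printing Implicit Defensive.

Import Order.TTheory GRing.Theory Num.Theory.
Local Open Scope classical_set_scope.
Local Open Scope ring_scope.
Local Open Scope card_scope.

Definition letter : Type := bool.
Definition lX : letter := false.
Definition lY : letter := true.
Definition word : Type := seq letter.

Definition cyclically_equivalent (v w : word) : Prop := exists k : nat, v = rot k w.

(* A sequence (beta_w)_{|w| <= 4} is given by a function on all words; its
   values on words of length greater than 4 are junk and are never used. *)
Definition tracial_sequence (R : realType) (beta : word -> R) : Prop :=
  (forall v w : word, (size v <= 4)%N -> (size w <= 4)%N ->
     cyclically_equivalent v w -> beta v = beta w) /\
  (forall w : word, (size w <= 4)%N -> beta w = beta (rev w)).

Definition normalized (R : realType) (beta : word -> R) : Prop := beta [::] = 1.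

Definition nc_condition (R : realType) (beta : word -> R) : Prop :=
  beta [:: lX; lX; lY; lY] <> beta [:: lX; lY; lX; lY].

Definition cm_condition (R : realType) (beta : word -> R) : Prop :=
  beta [:: lX; lX; lY; lY] = beta [:: lX; lY; lX; lY].

Definition nc_sequence (R : realType) (beta : word -> R) : Prop :=
  tracial_sequence beta /\ nc_condition beta.

Definition cm_sequence (R : realType) (beta : word -> R) : Prop :=
  tracial_sequence beta /\ cm_condition beta.

Definition basis2 : seq word :=
  [:: [::]; [:: lX]; [:: lY];
      [:: lX; lX]; [:: lX; lY]; [:: lY; lX]; [:: lY; lY]].

Definition moment_matrix (R : realType) (beta : word -> R) : 'M[R]_7 :=
  \matrix_(i < 7, j < 7) beta (rev (nth [::] basis2 i) ++ nth [::] basis2 j).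

(* Meaningful for |w| <= 2 only, i.e. for w in basis2. *)
Definition word_col (R : realType) (M : 'M[R]_7) (w : word) : 'cV[R]_7 :=
  col (inord (index w basis2)) M.

Definition cm_moment_matrix (R : realType) (M : 'M[R]_7) : Prop :=
  exists gamma : word -> R, cm_sequence gamma /\ M = moment_matrix gamma.

Definition psd (R : realType) (n : nat) (M : 'M[R]_n) : Prop :=
  M^T = M /\ forall v : 'cV[R]_n, 0 <= (v^T *m M *m v) 0 0.

(* A polynomial g = sum a_ij x^i y^j of degree at most 2 is given by its
   coefficients; those with i + j > 2 are ignored. *)
Definition poly2_eval (R : realType) (a : 'I_3 -> 'I_3 -> R) (x y : R) : R :=
  \sum_(i < 3) \sum_(j < 3 | (i + j <= 2)%N) a i j * x ^+ i * y ^+ j.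

Definition poly2_col (R : realType) (M : 'M[R]_7) (a : 'I_3 -> 'I_3 -> R) : 'cV[R]_7 :=
  \sum_(i < 3) \sum_(j < 3 | (i + j <= 2)%N)
     a i j *: word_col M (nseq i lX ++ nseq j lY).

Definition variety (R : realType) (M : 'M[R]_7) : set (R * R) :=
  [set p | forall a : 'I_3 -> 'I_3 -> R, poly2_col M a = 0 -> poly2_eval a p.1 p.2 = 0].

(* The cardinality on the right may be infinite. *)
Definition rank_le_card_variety (R : realType) (M : 'M[R]_7) : Prop :=
  `I_(\rank M) #<= variety M.

Definition ntrace (R : realType) (t : nat) (A : 'M[R]_t) : R := (t%:R)^-1 * \tr A.

Definition word_eval (R : realType) (t : nat) (A B : 'M[R]_t) (w : word) : 'M[R]_t :=
  \big[mulmx/1%:M]_(c <- w) (if c == lX then A else B).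

Definition pair_moment_matrix (R : realType) (t : nat) (A B : 'M[R]_t) : 'M[R]_7 :=
  moment_matrix (fun w => ntrace (word_eval A B w)).

Record atom (R : realType) := Atom {
  atom_size : nat;
  atom_X : 'M[R]_atom_size;
  atom_Y : 'M[R]_atom_size;
  atom_size_gt0 : (0 < atom_size)%N;
  atom_X_sym : atom_X^T = atom_X;
  atom_Y_sym : atom_Y^T = atom_Y }.

(* Atoms are required to be distinct, so that the number of atoms of a given
   size counts the points carrying mass. *)
Record measure (R : realType) := Measure {
  natoms : nat;
  atom_of : 'I_natoms -> atom R;
  weight : 'I_natoms -> R;
  atom_of_inj : injective atom_of;
  weight_gt0 : forall k, 0 < weight k;
  weight_sum1 : \sum_k weight k = 1 }.
Arguments atom_of {R} m _.
Arguments weight {R} m _.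

Definition represents (R : realType) (mu : measure R) (beta : word -> R) : Prop :=
  forall w : word, (size w <= 4)%N ->
    beta w = \sum_k weight mu k *
      ntrace (word_eval (atom_X (atom_of mu k)) (atom_Y (atom_of mu k)) w).

Definition natoms_of_size (R : realType) (mu : measure R) (i : nat) : nat :=
  #|[pred k | atom_size (atom_of mu k) == i]|.

(* The type (m_1, ..., m_r) is the list m with m_i = nth 0 m (i - 1); entries
   beyond r are 0, so mu has no atom of size greater than r. *)
Definition has_type (R : realType) (mu : measure R) (m : seq nat) : Prop :=
  last 0%N m <> 0%N /\ forall i : nat, natoms_of_size mu i.+1 = nth 0%N m i.

(* First by length r, then by m_r, m_{r-1}, ..., m_1 lexicographically. *)
Definition type_lt (m n : seq nat) : Prop :=
  (size m < size n)%N \/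
  size m = size n /\
    exists k : nat, (nth 0 m k < nth 0 n k)%N /\
      forall j : nat, (k < j)%N -> nth 0%N m j = nth 0%N n j.

Definition minimal_measure (R : realType) (mu : measure R) (beta : word -> R) : Prop :=
  represents mu beta /\
  forall (nu : measure R) (m n : seq nat),
    represents nu beta -> has_type mu m -> has_type nu n -> ~ type_lt n m.

Definition admits_nc_measure (R : realType) (beta : word -> R) : Prop :=
  exists (mu : measure R) (m : seq nat),
    [/\ minimal_measure mu beta, has_type mu m & (1 < size m)%N].

(* For an nc sequence every representing measure is an nc measure. *)
Definition has_nc_measure_of_type (R : realType) (beta : word -> R) (m : seq nat) : Prop :=
  exists mu : measure R, represents mu beta /\ has_type mu m.

Definition mat2 (R : realType) (a b c d : R) : 'M[R]_2 :=
  \matrix_(i < 2, j < 2) nth 0 (nth [::] [:: [:: a; b]; [:: c; d]] i) j.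

Definition smallest_rank_drop (R : realType) (M N : 'M[R]_7) (xi : R) : Prop :=
  [/\ 0 < xi, (\rank (M - xi *: N)%R < \rank M)%N
    & forall eta : R, 0 < eta -> (\rank (M - eta *: N)%R < \rank M)%N -> xi <= eta].

(* Main.v *)
Require Import Defs.
From mathcomp Require Import all_boot all_order all_algebra.
From mathcomp Require Import boolp classical_sets functions cardinality reals.
From mathcomp Require Import ring lra zify.
Set Implicit Arguments.
Unset Strict Implicit.
Unset Printing Implicit Defensive.
Import Order.TTheory GRing.Theory Num.Theory.
Local Open Scope ring_scope.

(** Write a block for the pair (X, Y) of the statement, with al = 1/a1 and
    ga = 1/a3. Taking its weight to be xi = m al ga, where m is the moment of X^2Y^2,
    removes that moment and leaves an arrow-shaped quadratic form M in
    g0 + g1 X + g2 Y + g3 X^2 + g4 Y^2. A positive semidefinite M splits into two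
    truncated Hamburger problems on the coordinate axes sharing the constant term.
    Each is solvable unless M >= tau g3^2 (resp. tau g4^2) for some tau > 0; in that
    case a small decrease of al and a much smaller one of ga make M positive definite
    and the axis problems solvable, because the form of beta itself is positive
    definite. Hence one positive semidefinite M yields a measure with a single block.

    Conversely, every atom (A, B) of a representing measure satisfies AB + BA = 0.
    Compressing to the range of A^2B^2 kills all odd traces, and the moments of
    (A^2, B^2) there form a doubly nonnegative 3x3 matrix; subtracting the square of
    a suitable row removes its X^2Y^2 entry and stays doubly nonnegative, which
    provides a block with M positive semidefinite. When the odd moments vanish the
    same subtraction leaves two opposite points on one axis and the origin. *)

(** * Truncated Hamburger problem on one axis *)

(** The parameters are reciprocals because [X^2] and [Y^2] equal the scalars [1/al] and [1/ga] in
    the block, so that its form, scaled by its weight, is [m] times [al ga (g0 + g3/al + g4/ga)^2 +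
    ga g1^2 + al g2^2]. With [L = g0 + g4/ga], the product [L g3] has a coefficient free of [al]:
    moving [al] changes only the squares of [L], [g3] and [g2], which is what makes the perturbation
    computable. The obstacle is that a positive semidefinite Hankel matrix of degree four may
    require mass at infinity. Such mass is seen by the fourth moment alone, and this excess is the
    origin of [tau]. The two axes can be solved separately because the nodes found on each satisfy
    [k1 x + k2 x^2 = 1]. Their mass is then a function of the moments, and what remains for the
    origin is a value of the quadratic form, hence nonnegative. *)

Section HankelSide.
Variable R : realType.
Implicit Types (h : R) (s : seq (R * R)).

Definition hankel_form h0 h1 h2 h3 h4 (g0 g1 g2 : R) : R :=
  h0 * g0 ^+ 2 + 2 * h1 * g0 * g1 + h2 * (g1 ^+ 2 + 2 * g0 * g2)
  + 2 * h3 * g1 * g2 + h4 * g2 ^+ 2.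

Definition pmoment s (j : nat) : R := \sum_(a <- s) a.1 * a.2 ^+ j.

(** The first clause excludes a fourth moment with no node to carry it. In the second,
    [h2 ^+ 2 - h1 * h3] is the numerator of the leading coefficient [k2] of the node equation; if it
    vanishes while the determinant is positive, a node has escaped to infinity. *)
Definition good_side h1 h2 h3 h4 : Prop :=
  (h2 = 0 -> h4 = 0) /\ (0 < h2 * h4 - h3 ^+ 2 -> h2 ^+ 2 <> h1 * h3).

(** The node equation keeps every node away from 0. The moment of order 0 is not prescribed, since
    the origin and the other axis also contribute to the constant term. *)
Definition side_atoms h1 h2 h3 h4 (k1 k2 : R) s : Prop :=
  [/\ all (fun a => 0 <= a.1) s,
      all (fun a => k1 * a.2 + k2 * a.2 ^+ 2 == 1) s &
      [/\ pmoment s 1 = h1, pmoment s 2 = h2, pmoment s 3 = h3 & pmoment s 4 = h4]].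

(** Applied on a line through an isotropic vector of a nonnegative form, this shows that the vector
    is orthogonal to the direction of the line. *)
Lemma linear_nonneg (a b c : R) : (forall t, 0 <= a * t ^+ 2 + b * t + c) -> c = 0 -> b = 0.
Proof.
move=> H c0; have [//|b0] := eqVneq b 0.
pose d := 1 + `|a|; have d0 : 0 < d by rewrite /d; have := normr_ge0 a; lra.
have ad : a < d by rewrite /d; have := ler_norm a; lra.
have := H (- b / d); rewrite c0.
have -> : a * (- b / d) ^+ 2 + b * (- b / d) + 0 = (b / d) ^+ 2 * (a - d).
  by field; lra.
have : 0 < (b / d) ^+ 2 by rewrite exprn_even_gt0 //= mulf_neq0 // invr_neq0 //; lra.
nra.
Qed.

Lemma hankel_psd_facts h0 h1 h2 h3 h4 :
  (forall g0 g1 g2, 0 <= hankel_form h0 h1 h2 h3 h4 g0 g1 g2) ->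
  [/\ 0 <= h2, 0 <= h4, 0 <= h2 * h4 - h3 ^+ 2,
      h2 = 0 -> h1 = 0 /\ h3 = 0 &
      h2 * h4 - h3 ^+ 2 = 0 -> h2 ^+ 2 = h1 * h3].
Proof.
rewrite /hankel_form => H.
have h2ge : 0 <= h2 by have := H 0 1 0; lra.
have h4ge : 0 <= h4 by have := H 0 0 1; lra.
have Hz : h2 = 0 -> h1 = 0 /\ h3 = 0.
  move=> h20; split.
    have: 2 * h1 = 0; last by lra.
    apply: (@linear_nonneg h0 _ 0) => // t; have := H t 1 0; rewrite h20; lra.
  have: 2 * h3 = 0; last by lra.
  apply: (@linear_nonneg h4 _ 0) => // t; have := H 0 1 t; rewrite h20; lra.
split=> //.
  have [h20|h2n] := eqVneq h2 0; first by have [_ ->] := Hz h20; rewrite h20; lra.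
  have h2p : 0 < h2 by lra.
  have := H 0 h3 (- h2); have -> : h0 * 0 ^+ 2 + 2 * h1 * 0 * h3 + h2 * (h3 ^+ 2 + 2 * 0 * - h2) + 2 * h3 * h3 * - h2 +
   h4 * (- h2) ^+ 2 = h2 * (h2 * h4 - h3 ^+ 2) by ring.
  by rewrite pmulr_rge0.
(* When the determinant vanishes, [(0, h3, - h2)] is isotropic, hence orthogonal to the constant
   direction; that pairing is [h1 * h3 - h2 ^+ 2]. *)
move=> D0; have : 2 * (h1 * h3 - h2 ^+ 2) = 0; last by lra.
apply: (@linear_nonneg h0 _ (h2 * (h2 * h4 - h3 ^+ 2))); last by rewrite D0 mulr0.
by move=> t; have := H t h3 (- h2); congr (_ <= _); ring.
Qed.

(** Integrating [k1 x + k2 x^2 = 1] against [x] and [x^2] gives a linear system for [k1], [k2] with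
    determinant [h2 h4 - h3^2]. When [h2] is positive, a zero determinant leaves one node and a
    positive one gives the two roots. *)
Lemma good_side_atoms h0 h1 h2 h3 h4 :
  (forall g0 g1 g2, 0 <= hankel_form h0 h1 h2 h3 h4 g0 g1 g2) ->
  good_side h1 h2 h3 h4 ->
  exists k1 k2 s, side_atoms h1 h2 h3 h4 k1 k2 s.
Proof.
move=> /hankel_psd_facts [h2ge h4ge Dge h2z Dz] [gx2 gx4].
have [h20|h2n] := eqVneq h2 0.
  have [-> ->] := h2z h20; exists 0, 0, [::].
  by split=> //; rewrite /pmoment !big_nil (gx2 h20) h20.
have h2p : 0 < h2 by lra.
have [D0|Dn] := eqVneq (h2 * h4 - h3 ^+ 2) 0.
  have e := Dz D0.
  have h13 : h1 * h3 != 0 by rewrite -e expf_neq0.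
  have [h1n h3n] : h1 != 0 /\ h3 != 0 by move: h13; rewrite mulf_eq0 negb_or => /andP.
  have h1E : h1 = h2 ^+ 2 / h3 by apply: (mulIf h3n); rewrite -e mulfVK.
  have h4E : h4 = h3 ^+ 2 / h2 by apply: (mulIf h2n); rewrite mulfVK //; lra.
  (* A single node has to be [x = h3 / h2], with mass [h2 / x^2]. *)
  exists (h2 / h3), 0, [:: (h2 ^+ 3 / h3 ^+ 2, h3 / h2)].
  rewrite /side_atoms /pmoment !big_seq1 /= !andbT; split.
  - by rewrite divr_ge0 ?sqr_ge0 ?exprn_ge0.
  - by apply/eqP; field; rewrite h2n h3n.
  - by rewrite h1E h4E; split; field; rewrite ?h2n ?h3n.
have Dp : 0 < h2 * h4 - h3 ^+ 2 by lra.
pose D := h2 * h4 - h3 ^+ 2.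
pose k1 := (h1 * h4 - h2 * h3) / D; pose k2 := (h2 ^+ 2 - h1 * h3) / D.
have k2n : k2 != 0.
  by rewrite mulf_neq0 ?invr_neq0 // subr_eq0; apply/eqP/gx4.
have e1 : k1 * h2 + k2 * h3 = h1 by rewrite /k1 /k2 /D; field; exact: Dn.
have e2 : k1 * h3 + k2 * h4 = h2 by rewrite /k1 /k2 /D; field; exact: Dn.
(* The mass the nodes must have. The minor [sg * h2 - h1 ^+ 2] is positive because [k2] is nonzero,
   and it yields both the reality of the nodes and the positivity of the weights. *)
pose sg := k1 * h1 + k2 * h2.
have minor : sg * h2 - h1 ^+ 2 = D * k2 ^+ 2 by rewrite /sg /k1 /k2 /D; field; exact: Dn.
have minor_gt0 : 0 < sg * h2 - h1 ^+ 2.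
  by rewrite minor mulr_gt0 // exprn_even_gt0.
have disc : 0 < k1 ^+ 2 + 4 * k2.
  have [k2p|k2m] := ltrP 0 k2; first by have := sqr_ge0 k1; lra.
  have {}k2m : k2 < 0 by lra.
  have e : (k1 ^+ 2 + 4 * k2) * h1 ^+ 2 = (2 * sg - k1 * h1) ^+ 2 - 4 * k2 * (sg * h2 - h1 ^+ 2).
    by rewrite /sg; ring.
  have P : 0 < (k1 ^+ 2 + 4 * k2) * h1 ^+ 2 by rewrite e; have := sqr_ge0 (2 * sg - k1 * h1); nra.
  rewrite ltNge; apply/negP => d0.
  by have := sqr_ge0 h1; nra.
pose r := Num.sqrt (k1 ^+ 2 + 4 * k2).
have r2 : r ^+ 2 = k1 ^+ 2 + 4 * k2 by rewrite sqr_sqrtr // ltW.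
have rp : 0 < r by rewrite sqrtr_gt0.
have rn : r != 0 by lra.
(* reciprocals of the nodes, i.e. the roots of z^2 - k1 z - k2 *)
pose z1 := (k1 + r) / 2; pose z2 := (k1 - r) / 2.
have z1E : z1 ^+ 2 = k1 * z1 + k2 by rewrite /z1; nra.
have z2E : z2 ^+ 2 = k1 * z2 + k2 by rewrite /z2; nra.
have z12 : z1 * z2 = - k2 by rewrite /z1 /z2; nra.
have z1n : z1 != 0 by apply: contraNneq k2n => z10; rewrite -oppr_eq0 -z12 z10 mul0r.
have z2n : z2 != 0 by apply: contraNneq k2n => z20; rewrite -oppr_eq0 -z12 z20 mulr0.
have dz : z1 - z2 = r by rewrite /z1 /z2; lra.
(* The shares of the two nodes in the second moment: they solve [W1 + W2 = h2] and
   [W1 z1 + W2 z2 = h1]. Having positive sum and product, both are positive. *)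
pose W1 := (h1 - h2 * z2) / r; pose W2 := (h2 * z1 - h1) / r.
have WS : W1 + W2 = h2 by rewrite /W1 /W2 -dz; field; rewrite dz.
have WZ : W1 * z1 + W2 * z2 = h1 by rewrite /W1 /W2 -dz; field; rewrite dz.
have WP : W1 * W2 * r ^+ 2 = sg * h2 - h1 ^+ 2.
  have -> : W1 * W2 * r ^+ 2 = (h1 - h2 * z2) * (h2 * z1 - h1) by rewrite /W1 /W2; field.
  have zs : z1 + z2 = k1 by rewrite /z1 /z2; lra.
  have -> : (h1 - h2 * z2) * (h2 * z1 - h1) = h1 * h2 * (z1 + z2) - h1 ^+ 2 - h2 ^+ 2 * (z1 * z2) by ring.
  by rewrite zs z12 /sg; ring.
have WP0 : 0 < W1 * W2.
  by rewrite -(pmulr_lgt0 _ (exprn_gt0 2 rp)) WP.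
have W1p : 0 < W1 by nra.
have W2p : 0 < W2 by nra.
have zi (z : R) : z != 0 -> z ^+ 2 = k1 * z + k2 -> k2 / z = z - k1.
  by move=> zn zE; apply: (mulIf zn); rewrite mulfVK // mulrBl -expr2 zE; ring.
have m3 : W1 / z1 + W2 / z2 = h3.
  apply: (mulfI k2n).
  have -> : k2 * (W1 / z1 + W2 / z2) = W1 * (k2 / z1) + W2 * (k2 / z2) by ring.
  rewrite (zi _ z1n z1E) (zi _ z2n z2E).
  have -> : W1 * (z1 - k1) + W2 * (z2 - k1) = (W1 * z1 + W2 * z2) - k1 * (W1 + W2) by ring.
  by rewrite WZ WS -{1}e1; ring.
have m4 : W1 / z1 ^+ 2 + W2 / z2 ^+ 2 = h4.
  apply: (mulfI k2n).
  have -> : k2 * (W1 / z1 ^+ 2 + W2 / z2 ^+ 2) = W1 / z1 * (k2 / z1) + W2 / z2 * (k2 / z2).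
    by field; rewrite z1n z2n.
  rewrite (zi _ z1n z1E) (zi _ z2n z2E).
  have -> : W1 / z1 * (z1 - k1) + W2 / z2 * (z2 - k1) = W1 + W2 - k1 * (W1 / z1 + W2 / z2).
    by field; rewrite z1n z2n.
  by rewrite m3 WS -{1}e2; ring.
exists k1, k2, [:: (W1 * z1 ^+ 2, z1^-1); (W2 * z2 ^+ 2, z2^-1)].
rewrite /side_atoms /pmoment !big_cons !big_nil /= !andbT; split.
- by apply/andP; split; apply: mulr_ge0; rewrite ?sqr_ge0 // ltW.
- apply/andP; split; apply/eqP.
    by apply: (mulIf (expf_neq0 2 z1n)); rewrite mul1r {2}z1E; field.
  by apply: (mulIf (expf_neq0 2 z2n)); rewrite mul1r {2}z2E; field.
- split.
  + by rewrite -WZ; field; rewrite z1n z2n.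
  + by rewrite -WS; field; rewrite z1n z2n.
  + by rewrite -m3; field; rewrite z1n z2n.
  + by rewrite -m4; field; rewrite z1n z2n.
Qed.

End HankelSide.

(** * Quadratic forms of quartic moment data *)

Section QuarticForms.
Variable R : realType.
Implicit Types (al ga tau g d : R).

Record quartic := Quartic {
  c0 : R; cX : R; cY : R; cXX : R; cYY : R;
  cXXX : R; cYYY : R; cXXXX : R; cYYYY : R; cXXYY : R }.

Definition quartic_swap (b : quartic) : quartic :=
  Quartic (c0 b) (cY b) (cX b) (cYY b) (cXX b) (cYYY b) (cXXX b) (cYYYY b) (cXXXX b) (cXXYY b).

(** The moment matrix restricted to [1, X, Y, X^2, Y^2], all mixed moments there being zero except
    that of [X^2 Y^2]. *)
Definition qform (b : quartic) (g0 g1 g2 g3 g4 : R) : R :=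
  c0 b * g0 ^+ 2 + 2 * cX b * g0 * g1 + 2 * cY b * g0 * g2
  + cXX b * (g1 ^+ 2 + 2 * g0 * g3) + cYY b * (g2 ^+ 2 + 2 * g0 * g4)
  + 2 * cXXX b * g1 * g3 + 2 * cYYY b * g2 * g4
  + cXXXX b * g3 ^+ 2 + cYYYY b * g4 ^+ 2 + 2 * cXXYY b * g3 * g4.

Definition qpsd (b : quartic) : Prop := forall g0 g1 g2 g3 g4, 0 <= qform b g0 g1 g2 g3 g4.

Definition qpd (b : quartic) : Prop :=
  forall g0 g1 g2 g3 g4, ~ [/\ g0 = 0, g1 = 0, g2 = 0, g3 = 0 & g4 = 0] ->
  0 < qform b g0 g1 g2 g3 g4.

Lemma qpd_cXX_gt0 b : qpd b -> 0 < cXX b.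
Proof.
move=> H; have : 0 < qform b 0 1 0 0 0 by apply: H => -[_ /eqP]; rewrite oner_eq0.
by rewrite /qform; lra.
Qed.

Lemma qpd_cXXXX_gt0 b : qpd b -> 0 < cXXXX b.
Proof.
move=> H; have : 0 < qform b 0 0 0 1 0 by apply: H => -[_ _ _ /eqP]; rewrite oner_eq0.
by rewrite /qform; lra.
Qed.

(** Subtracts [m al ga] times the moments of the block, where [X^2 = 1/al] and [Y^2 = 1/ga]; the
    last entry is [m - m]. *)
Definition remove_block (b : quartic) (al ga : R) : quartic :=
  let m := cXXYY b in
  Quartic (c0 b - m * al * ga) (cX b) (cY b) (cXX b - m * ga) (cYY b - m * al)
    (cXXX b) (cYYY b) (cXXXX b - m * ga / al) (cYYYY b - m * al / ga) 0.

Definition axes_rep_by (b : quartic) (w0 : R) (sx sy : seq (R * R)) : Prop :=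
  [/\ 0 <= w0, all (fun a => 0 <= a.1) sx & all (fun a => 0 <= a.1) sy] /\
  [/\ c0 b = w0 + pmoment sx 0 + pmoment sy 0,
      [/\ pmoment sx 1 = cX b, pmoment sx 2 = cXX b, pmoment sx 3 = cXXX b
        & pmoment sx 4 = cXXXX b],
      [/\ pmoment sy 1 = cY b, pmoment sy 2 = cYY b, pmoment sy 3 = cYYY b
        & pmoment sy 4 = cYYYY b] & cXXYY b = 0].

Definition axes_rep (b : quartic) : Prop := exists w0 sx sy, axes_rep_by b w0 sx sy.

Lemma qform_swap b g0 g1 g2 g3 g4 :
  qform (quartic_swap b) g0 g1 g2 g3 g4 = qform b g0 g2 g1 g4 g3.
Proof. by rewrite /qform /=; ring. Qed.

Lemma qpsd_swap b : qpsd b -> qpsd (quartic_swap b).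
Proof. by move=> H g0 g1 g2 g3 g4; rewrite qform_swap. Qed.

Lemma qpd_swap b : qpd b -> qpd (quartic_swap b).
Proof. by move=> H g0 g1 g2 g3 g4 ne; rewrite qform_swap; apply: H => -[*]; apply: ne. Qed.

Lemma remove_block_swap b al ga :
  remove_block (quartic_swap b) al ga = quartic_swap (remove_block b ga al).
Proof. by rewrite /remove_block /quartic_swap /=; congr Quartic; ring. Qed.

Lemma axes_rep_swap b : axes_rep b -> axes_rep (quartic_swap b).
Proof.
move=> [w0 [sx [sy [[? ? ?] [e0 ? ? ?]]]]]; exists w0, sy, sx; split=> //; split=> //=.
by rewrite e0; ring.
Qed.

Lemma qpsd_hankel b : qpsd b ->
  forall g0 g1 g2, 0 <= hankel_form (c0 b) (cX b) (cXX b) (cXXX b) (cXXXX b) g0 g1 g2.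
Proof.
by move=> H g0 g1 g2; have := H g0 g1 0 g2 0; congr (_ <= _); rewrite /qform /hankel_form; ring.
Qed.

(** Multiplying the node equation by [x^j] and integrating expresses each moment by the next two. *)
Lemma side_atoms_mass (h1 h2 h3 h4 k1 k2 : R) s :
  side_atoms h1 h2 h3 h4 k1 k2 s ->
  [/\ pmoment s 0 = k1 * h1 + k2 * h2, h1 = k1 * h2 + k2 * h3 & h2 = k1 * h3 + k2 * h4].
Proof.
move=> [_ /allP kP [<- <- <- <-]].
have E j : pmoment s j = k1 * pmoment s j.+1 + k2 * pmoment s j.+2.
  rewrite /pmoment !mulr_sumr -big_split /= !big_seq; apply: eq_bigr => a /kP /eqP e.
  by rewrite -[LHS]mulr1 -e !exprS; ring.
by split.
Qed.

(** The polynomial [1 - k1 X - k2 X^2 - l1 Y - l2 Y^2] vanishes at all nodes of both axes and equals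
    1 at the origin, so the form at it is the mass left for the origin. *)
Lemma good_axes_rep b : qpsd b -> cXXYY b = 0 ->
  good_side (cX b) (cXX b) (cXXX b) (cXXXX b) ->
  good_side (cY b) (cYY b) (cYYY b) (cYYYY b) -> axes_rep b.
Proof.
move=> H m0 gx gy.
have [k1 [k2 [sx Sx]]] := good_side_atoms (qpsd_hankel H) gx.
have [l1 [l2 [sy Sy]]] := good_side_atoms (qpsd_hankel (qpsd_swap H)) gy.
have [x0 x1 x2] := side_atoms_mass Sx; have [y0 y1 y2] := side_atoms_mass Sy.
exists (c0 b - pmoment sx 0 - pmoment sy 0), sx, sy.
case: Sx Sy => [sx0 _ ?] [sy0 _ ?]; split; last by split=> //; ring.
split=> //; have := H 1 (- k1) (- l1) (- k2) (- l2); congr (_ <= _).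
rewrite /qform x0 y0 m0.
have -> : c0 b - (k1 * cX b + k2 * cXX b) - (l1 * cY b + l2 * cYY b) =
  c0 b - 2 * (k1 * cX b + k2 * cXX b) - 2 * (l1 * cY b + l2 * cYY b)
  + k1 * cX b + k2 * cXX b + l1 * cY b + l2 * cYY b by ring.
move: x1 x2 y1 y2 => /=; move: (cX b) (cXX b) (cY b) (cYY b) => u1 u2 v1 v2 x1 x2 y1 y2.
rewrite {3}x1 {4}x2 {3}y1 {4}y2; ring.
Qed.

(* [h2 = 0 < h4], or a single atom with excess fourth moment. *)
Lemma bad_side_strict b : qpsd b -> cXXYY b = 0 ->
  ~ good_side (cX b) (cXX b) (cXXX b) (cXXXX b) ->
  exists2 tau, 0 < tau & forall g0 g1 g2 g3 g4, tau * g3 ^+ 2 <= qform b g0 g1 g2 g3 g4.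
Proof.
move=> H m0 nb; have [h2ge h4ge Dge h2z Dz] := hankel_psd_facts (qpsd_hankel H).
have [h20|h2n] := eqVneq (cXX b) 0.
  have [h10 h30] := h2z h20.
  have h4n : cXXXX b != 0.
    by apply/eqP => h40; apply: nb; split=> //; rewrite h20 h30; lra.
  exists (cXXXX b); first by lra.
  move=> g0 g1 g2 g3 g4; have := H g0 0 g2 0 g4.
  by rewrite /qform h20 h10 h30 m0; lra.
have h2p : 0 < cXX b by lra.
have [Dp e] : 0 < cXX b * cXXXX b - cXXX b ^+ 2 /\ cXX b ^+ 2 = cX b * cXXX b.
  by apply: contrapT => nDe; apply: nb; split=> [z|Dp e]; [lra | apply: nDe].
have [h1n h3n] : cX b != 0 /\ cXXX b != 0.
  have : cX b * cXXX b != 0 by rewrite -e expf_neq0.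
  by rewrite mulf_eq0 negb_or => /andP.
exists ((cXX b * cXXXX b - cXXX b ^+ 2) / cXX b); first by rewrite divr_gt0.
move=> g0 g1 g2 g3 g4.
have h3E : cXXX b = cXX b ^+ 2 / cX b by apply: (mulfI h1n); rewrite -e; field.
(* The middle square is the atom at [x = h2 / h1] of mass [h1^2 / h2], which accounts for all side
   moments except the excess in [h4]. The remainder involves neither [g1] nor [g3]; it is evaluated
   where the atom's square is zero. *)
have -> : qform b g0 g1 g2 g3 g4 = (cXX b * cXXXX b - cXXX b ^+ 2) / cXX b * g3 ^+ 2
   + cX b ^+ 2 / cXX b * (g0 + cXX b / cX b * g1 + (cXX b / cX b) ^+ 2 * g3) ^+ 2
   + qform b g0 (- (cX b / cXX b * g0)) g2 0 g4.
  by rewrite /qform m0 h3E; field; rewrite h1n h2n.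
rewrite -addrA lerDl addr_ge0 //.
by rewrite mulr_ge0 ?sqr_ge0 // divr_ge0 ?sqr_ge0.
Qed.

(** In the block, [X^2] and [Y^2] are scalar, while [X] and [Y] are traceless and orthogonal to each
    other; hence three separate squares. *)
Lemma qform_remove_block b al ga g0 g1 g2 g3 g4 : al != 0 -> ga != 0 ->
  qform (remove_block b al ga) g0 g1 g2 g3 g4 = qform b g0 g1 g2 g3 g4
  - cXXYY b * (al * ga * (g0 + g3 / al + g4 / ga) ^+ 2 + ga * g1 ^+ 2 + al * g2 ^+ 2).
Proof. by move=> an gn; rewrite /qform /=; field; rewrite an gn. Qed.

(** Lowering [al] gains multiples of [(g0 + g4 / ga)^2] and [g2^2], and loses only a multiple of
    [g3^2] of order [d], which [tau] pays for. *)
Lemma decrease_al b al ga tau : 0 < cXXYY b -> 0 < al -> 0 < ga -> 0 < tau ->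
  (forall g0 g1 g2 g3 g4, tau * g3 ^+ 2 <= qform (remove_block b al ga) g0 g1 g2 g3 g4) ->
  exists2 d0, 0 < d0 & forall d, 0 < d -> d < d0 -> 0 < al - d /\
    exists2 tau1, 0 < tau1 & forall g0 g1 g2 g3 g4,
      tau1 * (g3 ^+ 2 + (g0 + g4 / ga) ^+ 2 + g2 ^+ 2)
        <= qform (remove_block b (al - d) ga) g0 g1 g2 g3 g4.
Proof.
set m := cXXYY b => mp ap gp tp H.
(* The first bound gives [al - d >= al / 2]; with it, the second keeps the loss in [g3^2] below
   [tau / 2]. *)
exists (Num.min (al / 2) (tau * al ^+ 2 / (4 * m * ga))).
  by rewrite lt_min; apply/andP; split; rewrite divr_gt0 ?mulr_gt0 ?exprn_gt0.
move=> d dp; rewrite lt_min => /andP[d1 d2].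
have adp : 0 < al - d by lra.
split=> //.
have d2' : 2 * m * ga * d / al ^+ 2 <= tau / 2.
  rewrite ler_pdivrMr ?exprn_gt0 //.
  by move: d2; rewrite ltr_pdivlMr ?mulr_gt0 //; lra.
exists (Num.min (tau / 2) (Num.min (d * m * ga) (d * m))).
  by rewrite !lt_min !mulr_gt0 // invr_gt0.
set t1 := Num.min _ _.
have [ta tb tc] : [/\ t1 <= tau / 2, t1 <= d * m * ga & t1 <= d * m].
  by rewrite /t1; split; rewrite !ge_min lexx ?orbT.
move=> g0 g1 g2 g3 g4.
have -> : qform (remove_block b (al - d) ga) g0 g1 g2 g3 g4 =
  qform (remove_block b al ga) g0 g1 g2 g3 g4
  + d * m * ga * (g0 + g4 / ga) ^+ 2 + d * m * g2 ^+ 2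
  - m * ga * d / (al * (al - d)) * g3 ^+ 2.
  by rewrite /qform /= -/m; field; rewrite !gt_eqF.
have Hg := H g0 g1 g2 g3 g4.
have K : m * ga * d / (al * (al - d)) * g3 ^+ 2 <= tau / 2 * g3 ^+ 2.
  rewrite ler_wpM2r ?sqr_ge0 //; apply: le_trans d2'.
  have -> : 2 * m * ga * d / al ^+ 2 = m * ga * d * (2 / al ^+ 2) by field; rewrite gt_eqF.
  apply: ler_wpM2l; first by rewrite !mulr_ge0 // ltW.
  rewrite ler_pdivlMr ?exprn_gt0 // mulrC ler_pdivrMr ?mulr_gt0 //; nra.
have Ka : t1 * g3 ^+ 2 <= tau / 2 * g3 ^+ 2 by rewrite ler_wpM2r ?sqr_ge0.
have Kb : t1 * (g0 + g4 / ga) ^+ 2 <= d * m * ga * (g0 + g4 / ga) ^+ 2.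
  by rewrite ler_wpM2r ?sqr_ge0.
have Kc : t1 * g2 ^+ 2 <= d * m * g2 ^+ 2 by rewrite ler_wpM2r ?sqr_ge0.
move: (g3 ^+ 2) (g2 ^+ 2) ((g0 + g4 / ga) ^+ 2) (qform _ _ _ _ _ _) Hg K Ka Kb Kc.
move: (m * ga * d / _) => V y3 y2 L q Hg K Ka Kb Kc; lra.
Qed.

Lemma ler_cross (a x y : R) : 2 * a * x * y <= `|a| * (x ^+ 2 + y ^+ 2).
Proof.
have := sqr_ge0 (x - y); have := sqr_ge0 (x + y).
by have [a0|a0] := ger0P a; nra.
Qed.

Lemma ler_coef (a x : R) : a * x ^+ 2 <= `|a| * x ^+ 2.
Proof. by rewrite ler_wpM2r ?sqr_ge0 // ler_norm. Qed.

(* The only vectors not controlled by [tau1] are spanned by [X] and [1 - Y^2/a3];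
   the block form vanishes on the latter, and decreasing [ga] gains on the former. *)
Lemma decrease_ga b al ga tau1 : qpd b -> 0 < cXXYY b -> 0 < al -> 0 < ga -> 0 < tau1 ->
  (forall g0 g1 g2 g3 g4, tau1 * (g3 ^+ 2 + (g0 + g4 / ga) ^+ 2 + g2 ^+ 2)
        <= qform (remove_block b al ga) g0 g1 g2 g3 g4) ->
  exists2 d0, 0 < d0 & forall d, 0 < d -> d < d0 ->
    0 < ga - d /\ qpd (remove_block b al (ga - d)).
Proof.
move=> bpd; set m := cXXYY b => mp ap gp tp H.
have an : al != 0 by rewrite gt_eqF.
have gn : ga != 0 by rewrite gt_eqF.
(* The vector [e = 1 - ga Y^2] is invisible to the block, so its value is that of the positive
   definite form of [b]. *)
have [sg sgp sgE] : exists2 sg, 0 < sg & qform (remove_block b al ga) 1 0 0 0 (- ga) = 2 * sg.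
  exists (qform (remove_block b al ga) 1 0 0 0 (- ga) / 2); last by field.
  rewrite divr_gt0 // qform_remove_block // mul0r addr0 mulNr divff // subrr.
  rewrite !expr0n /= !mulr0 !addr0 mulr0 subr0; apply: bpd => -[e1 _ _ _ _].
  by move: (oner_neq0 R); rewrite e1 eqxx.
have [C Cp HC] : exists2 C, 0 < C & forall g1 g2 g3 L,
    qform (remove_block b al ga) 0 g1 g2 g3 (ga * L)
      <= C * (g1 ^+ 2 + g2 ^+ 2 + g3 ^+ 2 + L ^+ 2).
  rewrite /qform /=; move: (_ - _) (_ - _ * ga) (_ - _ * al) (_ - _ / al) (_ - _ / ga) => A2 A0 C2 A4 C4.
  exists (1 + `|A2| + `|C2| + `|cXXX b| + `|cYYY b * ga| + `|A4| + `|C4 * ga ^+ 2|).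
    by rewrite -!addrA ltr_wpDr // !addr_ge0.
  move=> g1 g2 g3 L.
  have i1 := ler_coef A2 g1; have i2 := ler_coef C2 g2; have i3 := ler_coef A4 g3.
  have i4 := ler_coef (C4 * ga ^+ 2) L; have i5 := ler_cross (cXXX b) g1 g3.
  have i6 := ler_cross (cYYY b * ga) g2 L.
  have -> : 2 * cYYY b * g2 * (ga * L) = 2 * (cYYY b * ga) * g2 * L by ring.
  have -> : C4 * (ga * L) ^+ 2 = (C4 * ga ^+ 2) * L ^+ 2 by ring.
  have n1 := normr_ge0 A2; have n2 := normr_ge0 C2; have n3 := normr_ge0 A4.
  have n4 := normr_ge0 (C4 * ga ^+ 2); have n5 := normr_ge0 (cXXX b).
  have n6 := normr_ge0 (cYYY b * ga).
  have s1 := sqr_ge0 g1; have s2 := sqr_ge0 g2; have s3 := sqr_ge0 g3; have s4 := sqr_ge0 L.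
  have p1 : 0 <= `|A2| * (g2 ^+ 2 + g3 ^+ 2 + L ^+ 2) by rewrite mulr_ge0 ?addr_ge0.
  have p2 : 0 <= `|C2| * (g1 ^+ 2 + g3 ^+ 2 + L ^+ 2) by rewrite mulr_ge0 ?addr_ge0.
  have p3 : 0 <= `|A4| * (g1 ^+ 2 + g2 ^+ 2 + L ^+ 2) by rewrite mulr_ge0 ?addr_ge0.
  have p4 : 0 <= `|C4 * ga ^+ 2| * (g1 ^+ 2 + g2 ^+ 2 + g3 ^+ 2) by rewrite mulr_ge0 ?addr_ge0.
  have p5 : 0 <= `|cXXX b| * (g2 ^+ 2 + L ^+ 2) by rewrite mulr_ge0 ?addr_ge0.
  have p6 : 0 <= `|cYYY b * ga| * (g1 ^+ 2 + g3 ^+ 2) by rewrite mulr_ge0 ?addr_ge0.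
  rewrite !mulr0 !mul0r !addr0 expr0n /= !mulr0 !add0r.
  lra.
(* Parallelogram identity for [v] and [w = (0, g1, g2, g3, ga L)]: here [v - w = g0 e], the value at
   [v + w] is nonnegative, and [C] bounds the value at [w]. *)
have HT g0 g1 g2 g3 g4 : let L := g0 + g4 / ga in let T := g3 ^+ 2 + L ^+ 2 + g2 ^+ 2 in
    sg * g0 ^+ 2 <= qform (remove_block b al ga) g0 g1 g2 g3 g4 + C * (g1 ^+ 2 + T).
  move=> L T; have i1 := HC g1 g2 g3 L.
  have i2 : 0 <= qform (remove_block b al ga) g0 (2 * g1) (2 * g2) (2 * g3) (g4 + ga * L).
    by apply: le_trans (H _ _ _ _ _); rewrite mulr_ge0 ?addr_ge0 ?sqr_ge0 // ltW.
  have i3 : 2 * sg * g0 ^+ 2 + qform (remove_block b al ga) g0 (2 * g1) (2 * g2) (2 * g3) (g4 + ga * L)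
     = 2 * qform (remove_block b al ga) g0 g1 g2 g3 g4 + 2 * qform (remove_block b al ga) 0 g1 g2 g3 (ga * L).
    have gL : ga * L = ga * g0 + g4 by rewrite /L; field.
    by rewrite gL -sgE /qform; ring.
  by rewrite /T; lra.
pose s := sg / (8 * al * C).
have sp : 0 < s by rewrite divr_gt0 // !mulr_gt0.
pose Cs := 1 / (al ^+ 2 * s) + 4 / s + 2.
have Csp : 0 < Cs by rewrite /Cs !addr_gt0 // divr_gt0 // mulr_gt0 // exprn_gt0.
(* For [L = g3 = 0] the right side is [- rho * g0 ^+ 2], which is small because [rho] will be of
   order [d]. Young's inequality with weight [s] pushes the cross terms into the part controlled by
   [tau1]. *)
have HS (g0 g2 g3 L rho : R) : 0 <= rho -> rho <= 1 ->
  - (rho + 2 * s) * g0 ^+ 2 - Cs * (g3 ^+ 2 + L ^+ 2 + g2 ^+ 2)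
    <= (g0 + g3 / al) ^+ 2 - (1 + rho) * (L - g0) ^+ 2.
  move=> r0 r1.
  have j1 : 0 <= s * g0 ^+ 2 + 2 * g0 * (g3 / al) + 1 / (al ^+ 2 * s) * g3 ^+ 2.
    have -> : s * g0 ^+ 2 + 2 * g0 * (g3 / al) + 1 / (al ^+ 2 * s) * g3 ^+ 2 = (s * g0 + g3 / al) ^+ 2 / s.
      by field; rewrite an gt_eqF.
    by rewrite divr_ge0 ?sqr_ge0 // ltW.
  have j2 : 0 <= s * g0 ^+ 2 + 2 * (1 + rho) * g0 * L + 4 / s * L ^+ 2.
    have : 0 <= (s * g0 + (1 + rho) * L) ^+ 2 / s by rewrite divr_ge0 ?sqr_ge0 // ltW.
    have -> : (s * g0 + (1 + rho) * L) ^+ 2 / s = s * g0 ^+ 2 + 2 * (1 + rho) * g0 * L + (1 + rho) ^+ 2 * (L ^+ 2 / s).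
      by field; rewrite gt_eqF.
    have : (1 + rho) ^+ 2 * (L ^+ 2 / s) <= 4 * (L ^+ 2 / s).
      apply: ler_wpM2r; first by rewrite divr_ge0 ?sqr_ge0 // ltW.
      have : 0 <= (1 - rho) * (3 + rho) by apply: mulr_ge0; lra.
      lra.
    have -> : 4 / s * L ^+ 2 = 4 * (L ^+ 2 / s) by ring.
    lra.
  have j3 : 0 <= 1 / (al ^+ 2 * s) * (L ^+ 2 + g2 ^+ 2).
    by rewrite mulr_ge0 ?addr_ge0 ?sqr_ge0 // divr_ge0 // mulr_ge0 ?sqr_ge0 // ltW.
  have j4 : 0 <= 4 / s * (g3 ^+ 2 + g2 ^+ 2).
    by rewrite mulr_ge0 ?addr_ge0 ?sqr_ge0 // divr_ge0 // ltW.
  have j5 : (1 + rho) * L ^+ 2 <= 2 * L ^+ 2 by rewrite ler_wpM2r ?sqr_ge0 //; lra.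
  have j6 := sqr_ge0 g3; have j7 := sqr_ge0 g2; have j8 := sqr_ge0 (g3 / al).
  rewrite /Cs; move: (1 / (al ^+ 2 * s)) (4 / s) (g3 / al) j1 j2 j3 j4 j8 => u v w.
  lra.
(* Collects every multiple of the old form spent on absorbing the change; the change itself carries
   a factor [d * m]. *)
pose G := 1 / (2 * C) + (1 / 2 + al * Cs) / tau1.
have Gp : 0 < G.
  by rewrite addr_gt0 // divr_gt0 // ?mulr_gt0 // addr_gt0 ?divr_gt0 // mulr_gt0.
(* The three bounds yield, in order, [rho <= 1], [rho * al <= sg / (4 * C)] and
   [d * m * G <= 1 / 2]. The choice of [s] makes [2 * s * al] equal to [sg / (4 * C)] as well, so
   half of the old form and half of the gain in [g1^2] survive. *)
exists (Num.min (ga / 2) (Num.min (ga * sg / (8 * al * C)) (1 / (2 * m * G)))).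
  by rewrite !lt_min; apply/and3P; split; rewrite divr_gt0 ?mulr_gt0.
move=> d dp; rewrite !lt_min => /and3P[d1 d2 d3].
have gdp : 0 < ga - d by lra.
split=> // g0 g1 g2 g3 g4 ne.
pose rho := d / (ga - d).
have r0 : 0 <= rho by rewrite divr_ge0 // ltW.
have r1 : rho <= 1 by rewrite ler_pdivrMr //; lra.
have r2 : rho <= sg / (4 * al * C).
  rewrite ler_pdivrMr //; have up : 0 < sg / (4 * al * C) by rewrite divr_gt0 ?mulr_gt0.
  have e : ga * sg / (8 * al * C) = sg / (4 * al * C) * (ga / 2).
    by field; rewrite an gt_eqF.
  have : 0 <= sg / (4 * al * C) * (ga / 2 - d) by apply: mulr_ge0; lra.
  move: d2; rewrite e; lra.
set L := g0 + g4 / ga; set T := g3 ^+ 2 + L ^+ 2 + g2 ^+ 2.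
set q' := qform (remove_block b al ga) g0 g1 g2 g3 g4.
have hs : - (rho + 2 * s) * g0 ^+ 2 - Cs * T <= (g0 + g3 / al) ^+ 2 - (1 + rho) * (L - g0) ^+ 2.
  exact: HS.
have ht : sg * g0 ^+ 2 <= q' + C * (g1 ^+ 2 + T) by exact: HT.
have hh : tau1 * T <= q' by exact: H.
have T0 : 0 <= T by rewrite !addr_ge0 ?sqr_ge0.
have q0 : 0 <= q' by apply: le_trans hh; rewrite mulr_ge0 // ltW.
have E0 : (rho + 2 * s) * al <= sg / (2 * C).
  have e1 : sg / (4 * al * C) * al = sg / (4 * C) by field; rewrite an gt_eqF.
  have e2 : 2 * s * al = sg / (4 * C) by rewrite /s; field; rewrite an gt_eqF.
  have e3 : sg / (2 * C) = sg / (4 * C) + sg / (4 * C) by field; rewrite gt_eqF.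
  by rewrite mulrDl e2 e3 lerD2r -e1 ler_pM2r.
have E1 : (rho + 2 * s) * al * g0 ^+ 2 <= q' / (2 * C) + g1 ^+ 2 / 2 + T / 2.
  apply: le_trans (_ : sg / (2 * C) * g0 ^+ 2 <= _); first by rewrite ler_wpM2r ?sqr_ge0.
  have -> : sg / (2 * C) * g0 ^+ 2 = sg * g0 ^+ 2 / (2 * C) by ring.
  have -> : q' / (2 * C) + g1 ^+ 2 / 2 + T / 2 = (q' + C * (g1 ^+ 2 + T)) / (2 * C).
    by field; rewrite gt_eqF.
  by rewrite ler_pM2r // invr_gt0 mulr_gt0.
have E2 : (1 / 2 + al * Cs) * T <= (1 / 2 + al * Cs) / tau1 * q'.
  have -> : (1 / 2 + al * Cs) * T = (1 / 2 + al * Cs) / tau1 * (tau1 * T).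
    by field; rewrite gt_eqF.
  apply: ler_wpM2l => //; rewrite divr_ge0 ?ltW // addr_gt0 ?divr_gt0 //.
  by rewrite mulr_gt0.
have E3 : d * m * G <= 1 / 2.
  move: d3; rewrite ltr_pdivlMr ?mulr_gt0 //; lra.
have -> : qform (remove_block b al (ga - d)) g0 g1 g2 g3 g4 =
   q' + d * m * (g1 ^+ 2 + al * ((g0 + g3 / al) ^+ 2 - (1 + rho) * (L - g0) ^+ 2)).
  by rewrite /q' /rho /L /qform /= -/m; field; rewrite gn an gt_eqF.
have F : q' / 2 + d * m * g1 ^+ 2 / 2 <= q' + d * m * (g1 ^+ 2 + al * ((g0 + g3 / al) ^+ 2 - (1 + rho) * (L - g0) ^+ 2)).
  have f1 : - (g1 ^+ 2 / 2) - G * q' <= al * ((g0 + g3 / al) ^+ 2 - (1 + rho) * (L - g0) ^+ 2).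
    apply: le_trans (ler_wpM2l (ltW ap) hs).
    have -> : al * (- (rho + 2 * s) * g0 ^+ 2 - Cs * T) =
      - ((rho + 2 * s) * al * g0 ^+ 2) - ((1 / 2 + al * Cs) * T) + T / 2 by ring.
    have -> : G * q' = q' / (2 * C) + (1 / 2 + al * Cs) / tau1 * q'.
      by rewrite /G; field; rewrite !gt_eqF.
    lra.
  have f2 := ler_wpM2l (mulr_ge0 (ltW dp) (ltW mp)) f1.
  have f3 := ler_wpM2r q0 E3.
  move: (al * _) f1 f2 => W f1 f2.
  rewrite mulrDr; move: (d * m * W) f2 => V f2.
  have e : d * m * (- (g1 ^+ 2 / 2) - G * q') = - (d * m * g1 ^+ 2 / 2) - d * m * G * q' by ring.
  move: f2; rewrite e => f2; move: (d * m * G * q') f2 f3 => Z f2 f3.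
  have -> : d * m * g1 ^+ 2 = d * m * g1 ^+ 2 / 2 + d * m * g1 ^+ 2 / 2 by field.
  lra.
apply: lt_le_trans F; rewrite ltNge; apply/negP => F.
have dm : 0 < d * m by rewrite mulr_gt0.
have k0 : 0 <= d * m * g1 ^+ 2 by rewrite mulr_ge0 ?sqr_ge0 // ltW.
have qz : q' = 0 by lra.
have g1z : g1 = 0.
  by apply/eqP; rewrite -sqrf_eq0 -(mulrI_eq0 _ (mulfI (lt0r_neq0 dm))); apply/eqP; lra.
have Tz : T = 0.
  by apply/eqP; rewrite -(mulrI_eq0 _ (mulfI (lt0r_neq0 tp))); apply/eqP; nra.
have [g3z [Lz g2z]] : g3 = 0 /\ L = 0 /\ g2 = 0.
  have := sqr_ge0 g3; have := sqr_ge0 L; have := sqr_ge0 g2; rewrite /T in Tz => *.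
  by repeat split; apply/eqP; rewrite -sqrf_eq0; apply/eqP; lra.
have g0z : g0 = 0.
  have := sqr_ge0 g0 => g0ge; apply/eqP; rewrite -sqrf_eq0; apply/eqP.
  by move: ht; rewrite qz g1z Tz; nra.
apply: ne; split=> //; move: Lz; rewrite /L g0z add0r => /eqP.
by rewrite mulf_eq0 invr_eq0 (negbTE gn) orbF => /eqP.
Qed.
End QuarticForms.

(** * Choosing and perturbing the block to be removed *)

Section BlockRemoval.
Variable R : realType.
Implicit Types (b : quartic R) (al ga tau g d : R).

Lemma perturb_al_ga b al ga tau : qpd b -> 0 < cXXYY b -> 0 < al -> 0 < ga -> 0 < tau ->
  (forall g0 g1 g2 g3 g4, tau * g3 ^+ 2 <= qform (remove_block b al ga) g0 g1 g2 g3 g4) ->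
  exists al' ga', [/\ 0 < al', 0 < ga' & axes_rep (remove_block b al' ga')].
Proof.
move=> bpd mp ap gp tp H.
have [d0 d0p H1] := decrease_al mp ap gp tp H.
(* A positive nonconstant affine function has an injective square, so of two sample points at least
   one avoids the forbidden value [e]. *)
have dodge (P : R -> R) k l e (e0 : R) : k != 0 -> 0 < e0 -> (forall d, P d = l + k * d) ->
    (forall d, 0 < d -> d < e0 -> 0 < P d) ->
    exists d, [/\ 0 < d, d < e0 & P d ^+ 2 <> e].
  move=> kn e0p PE Pp; have [E|] := pselect (P (e0 / 2) ^+ 2 = e); last first.
    by exists (e0 / 2); split=> //; lra.
  exists (e0 / 3); split; [lra | lra | move=> E'].
  have p1 : 0 < P (e0 / 2) by apply: Pp; lra.
  have p2 : 0 < P (e0 / 3) by apply: Pp; lra.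
  have /eqP : (P (e0 / 2) - P (e0 / 3)) * (P (e0 / 2) + P (e0 / 3)) = 0.
    by rewrite -subr_sqr E E' subrr.
  rewrite mulf_eq0 => /orP[|/eqP]; last by lra.
  have -> : P (e0 / 2) - P (e0 / 3) = k * (e0 / 6) by rewrite !PE; field.
  by rewrite mulf_eq0 (negbTE kn) => /eqP; lra.
have mn : cXXYY b != 0 by rewrite gt_eqF.
(* The second moment on the [Y] axis depends on [al] only and that on the [X] axis on [ga] only, so
   the two degeneracies are avoided one after the other. *)
have [d [dp dd dY]] : exists d, [/\ 0 < d, d < d0 &
    (cYY b - cXXYY b * (al - d)) ^+ 2 <> cY b * cYYY b].
  apply: (dodge (fun d => cYY b - cXXYY b * (al - d)) (cXXYY b) (cYY b - cXXYY b * al)) => //.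
    by move=> d; ring.
  move=> d dp dd; have [_ [t tp' Ht]] := H1 d dp dd.
  by have := Ht 0 0 1 0 0; rewrite /qform /=; lra.
have [adp [t tp' Ht]] := H1 d dp dd.
have [e0 e0p H2] := decrease_ga bpd mp adp gp tp' Ht.
have [e [ep ee eX]] : exists e, [/\ 0 < e, e < e0 &
    (cXX b - cXXYY b * (ga - e)) ^+ 2 <> cX b * cXXX b].
  apply: (dodge (fun e => cXX b - cXXYY b * (ga - e)) (cXXYY b) (cXX b - cXXYY b * ga)) => //.
    by move=> ?; ring.
  move=> e ep ee; have [_ Ht'] := H2 e ep ee.
  exact: (qpd_cXX_gt0 Ht').
have [gep Hpd] := H2 e ep ee.
exists (al - d), (ga - e); split=> //.
have pX : 0 < cXX b - cXXYY b * (ga - e).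
  exact: (qpd_cXX_gt0 Hpd).
have pY : 0 < cYY b - cXXYY b * (al - d).
  by have := Ht 0 0 1 0 0; rewrite /qform /=; lra.
apply: good_axes_rep => //.
- move=> g0 g1 g2 g3 g4.
  have [[-> -> -> -> ->]|ne] := pselect [/\ g0 = 0, g1 = 0, g2 = 0, g3 = 0 & g4 = 0].
    by rewrite /qform !expr0n /= !(mulr0, mul0r, addr0).
  exact/ltW/Hpd.
- by split=> /= [z|_]; [lra | exact: eX].
- by split=> /= [z|_]; [lra | exact: dY].
Qed.

Theorem psd_remove_axes_rep b al ga : qpd b -> 0 < cXXYY b -> 0 < al -> 0 < ga ->
  qpsd (remove_block b al ga) ->
  exists al' ga', [/\ 0 < al', 0 < ga' & axes_rep (remove_block b al' ga')].
Proof.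
move=> bpd mp ap gp H.
have [gx|bx] := pselect (good_side (cX b) (cXX b - cXXYY b * ga) (cXXX b) (cXXXX b - cXXYY b * ga / al)); last first.
  by have [tau tp Ht] := bad_side_strict H erefl bx; apply: perturb_al_ga tp Ht.
have [gy|bY] := pselect (good_side (cY b) (cYY b - cXXYY b * al) (cYYY b) (cYYYY b - cXXYY b * al / ga)).
  by exists al, ga; split=> //; apply: good_axes_rep.
have [tau tp Ht] := bad_side_strict (qpsd_swap H) erefl bY.
have [|al' [ga' [ap' gp' h]]] := @perturb_al_ga (quartic_swap b) ga al tau (qpd_swap bpd) mp gp ap tp.
  by move=> g0 g1 g2 g3 g4; rewrite remove_block_swap.
exists ga', al'; split=> //; move: (axes_rep_swap h).
by rewrite remove_block_swap; case: (remove_block b ga' al').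
Qed.

(* A doubly nonnegative 3x3 matrix stays so after removing a multiple of the square of its last
   (or, if that fails, its second) row. *)
Lemma exists_psd_remove b k00 k01 k02 k11 k22 :
  0 < cXXYY b -> 0 < k01 -> 0 < k02 ->
  (forall x y z, 0 <= k00 * x ^+ 2 + 2 * k01 * x * y + 2 * k02 * x * z
      + k11 * y ^+ 2 + 2 * cXXYY b * y * z + k22 * z ^+ 2) ->
  (forall g0 g1 g2 g3 g4, k00 * g0 ^+ 2 + 2 * k01 * g0 * g3 + 2 * k02 * g0 * g4
      + k11 * g3 ^+ 2 + 2 * cXXYY b * g3 * g4 + k22 * g4 ^+ 2 + k01 * g1 ^+ 2 + k02 * g2 ^+ 2
      <= qform b g0 g1 g2 g3 g4) ->
  exists al ga, [/\ 0 < al, 0 < ga & qpsd (remove_block b al ga)].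
Proof.
set m := cXXYY b => mp k01p k02p K H.
have k11p : 0 < k11.
  rewrite ltNge; apply/negP => k; have := K 0 (- (k22 + 1) / (2 * m)) 1; rewrite -/m.
  have -> : 2 * m * (- (k22 + 1) / (2 * m)) * 1 = - (k22 + 1) by field; rewrite gt_eqF.
  by have := sqr_ge0 (- (k22 + 1) / (2 * m)); nra.
have k22p : 0 < k22.
  rewrite ltNge; apply/negP => k; have := K 0 1 (- (k11 + 1) / (2 * m)); rewrite -/m.
  have -> : 2 * m * 1 * (- (k11 + 1) / (2 * m)) = - (k11 + 1) by field; rewrite gt_eqF.
  by have := sqr_ge0 (- (k11 + 1) / (2 * m)); nra.
have [c|c] := lerP (k02 * m) (k01 * k22).
  (* With these values the block is the square of the last row divided by its pivot [k22]. It uses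
     up [k02 g2^2] exactly, and [k01 g1^2] suffices by the case assumption. *)
  exists (k02 / m), (k02 / k22); rewrite !divr_gt0 //; split=> // g0 g1 g2 g3 g4.
  rewrite qform_remove_block -/m; try by rewrite gt_eqF // divr_gt0.
  apply: le_trans (lerB (H g0 g1 g2 g3 g4) (lexx _)).
  have := K g0 g3 (- (k02 * g0 + m * g3) / k22).
  have : 0 <= (k01 * k22 - k02 * m) * (g1 ^+ 2 / k22).
    by rewrite mulr_ge0 ?subr_ge0 // divr_ge0 ?sqr_ge0 // ltW.
  move=> i1 i2; apply: le_trans (addr_ge0 i1 i2) _; rewrite le_eqVlt; apply/orP; left; apply/eqP.
  by field; rewrite !gt_eqF.
(* If both rows failed, multiplying the two inequalities would contradict [m^2 <= k11 k22]. *)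
have c' : k01 * m <= k02 * k11.
  have dt : 0 <= k22 * (k11 * k22 - m ^+ 2).
    by have := K 0 k22 (- m); congr (_ <= _); rewrite -/m; ring.
  rewrite pmulr_rge0 // in dt.
  rewrite leNgt; apply/negP => c2.
  have := ltr_pM (mulr_ge0 (ltW k01p) (ltW k22p)) (mulr_ge0 (ltW k02p) (ltW k11p)) c c2.
  have : 0 <= k01 * k02 * (k11 * k22 - m ^+ 2) by rewrite mulr_ge0 // mulr_ge0 // ltW.
  lra.
exists (k01 / k11), (k01 / m); rewrite !divr_gt0 //; split=> // g0 g1 g2 g3 g4.
rewrite qform_remove_block -/m; try by rewrite gt_eqF // divr_gt0.
apply: le_trans (lerB (H g0 g1 g2 g3 g4) (lexx _)).
have i2 := K g0 (- (k01 * g0 + m * g4) / k11) g4.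
have i1 : 0 <= (k02 * k11 - k01 * m) * (g2 ^+ 2 / k11).
  by rewrite mulr_ge0 ?subr_ge0 // divr_ge0 ?sqr_ge0 // ltW.
apply: le_trans (addr_ge0 i1 i2) _; rewrite le_eqVlt; apply/orP; left; apply/eqP.
by field; rewrite !gt_eqF.
Qed.

(** The block is chosen to cancel both even moments on the [Y] axis. The rest is the Schur
    complement [h0, h1, h2] in the variable [X^2], matched by the origin and the points [u], [- u]
    with [u^2 = h2 / h1]; the last hypothesis says that [h1] is positive. *)
Lemma symmetric_removal b : qpd b -> 0 < cXXYY b -> 0 < cYY b -> cX b = 0 -> cY b = 0 ->
  cXXX b = 0 -> cYYY b = 0 -> cYY b * cXXYY b < cXX b * cYYYY b ->
  exists al ga w0 w u, [/\ 0 < al, 0 < ga, 0 < w0, 0 < w & 0 < u] /\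
    [/\ c0 (remove_block b al ga) = w0 + w,
        cXX (remove_block b al ga) = w * u ^+ 2, cXXXX (remove_block b al ga) = w * u ^+ 4,
        cYY (remove_block b al ga) = 0 & cYYYY (remove_block b al ga) = 0].
Proof.
move=> bpd mp Cp eX eY eX3 eY3 lt.
set m := cXXYY b in mp lt *; set C := cYY b in Cp lt *.
have C4p : 0 < cYYYY b := qpd_cXXXX_gt0 (qpd_swap bpd).
set C4 := cYYYY b in C4p lt *.
have [h0 h0E] : exists h0, h0 = c0 b - C ^+ 2 / C4 by eexists.
have [h1 h1E] : exists h1, h1 = cXX b - C * m / C4 by eexists.
have [h2 h2E] : exists h2, h2 = cXXXX b - m ^+ 2 / C4 by eexists.
have hE g0 g3 : qform b g0 0 0 g3 (- (C * g0 + m * g3) / C4) = h0 * g0 ^+ 2 + 2 * h1 * g0 * g3 + h2 * g3 ^+ 2.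
  by rewrite /qform h0E h1E h2E -/C -/m -/C4; field; rewrite gt_eqF.
have h1p : 0 < h1 by rewrite h1E subr_gt0 ltr_pdivrMr.
have h2p : 0 < h2.
  have : 0 < qform b 0 0 0 1 (- (C * 0 + m * 1) / C4) by apply: bpd => -[_ _ _ /eqP]; rewrite oner_eq0.
  by rewrite hE; lra.
have hd : 0 < h0 * h2 - h1 ^+ 2.
  have : 0 < qform b h2 0 0 (- h1) (- (C * h2 + m * - h1) / C4) by apply: bpd => -[h20]; lra.
  rewrite hE; have -> : h0 * h2 ^+ 2 + 2 * h1 * h2 * - h1 + h2 * (- h1) ^+ 2 = h2 * (h0 * h2 - h1 ^+ 2) by ring.
  by rewrite pmulr_rgt0.
exists (C / m), (C / C4), (h0 - h1 ^+ 2 / h2), (h1 ^+ 2 / h2), (Num.sqrt (h2 / h1)).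
have w0p : 0 < h0 - h1 ^+ 2 / h2 by rewrite subr_gt0 ltr_pdivrMr //; lra.
have wp : 0 < h1 ^+ 2 / h2 by apply: divr_gt0 => //; apply: exprn_gt0.
have up : 0 < Num.sqrt (h2 / h1) by rewrite sqrtr_gt0; apply: divr_gt0.
have u2 : Num.sqrt (h2 / h1) ^+ 2 = h2 / h1 by rewrite sqr_sqrtr //; apply/ltW/divr_gt0.
have u4 : Num.sqrt (h2 / h1) ^+ 4 = (h2 / h1) ^+ 2 by rewrite -[in RHS]u2 -exprM.
split; first by split=> //; apply: divr_gt0.
rewrite u2 u4 /= -/m -/C -/C4; split.
- by rewrite subrK h0E; field; rewrite !gt_eqF.
- have -> : h1 ^+ 2 / h2 * (h2 / h1) = h1 by field; rewrite !gt_eqF.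
  by rewrite h1E; field; rewrite gt_eqF.
- have -> : h1 ^+ 2 / h2 * (h2 / h1) ^+ 2 = h2 by field; rewrite !gt_eqF.
  by rewrite h2E; field; rewrite !gt_eqF.
- by field; rewrite !gt_eqF.
- by field; rewrite !gt_eqF.
Qed.

(** The product of the two opposite inequalities would contradict the positive minor of [X^2],
    [Y^2]. *)
Lemma symmetric_removal_or_swap b : qpd b -> 0 < cXXYY b -> 0 < cXX b -> 0 < cYY b ->
  cYY b * cXXYY b < cXX b * cYYYY b \/ cXX b * cXXYY b < cYY b * cXXXX b.
Proof.
move=> bpd mp Ap Cp; set m := cXXYY b in mp *.
have [c|c] := ltrP (cYY b * m) (cXX b * cYYYY b); [by left | right].
rewrite ltNge; apply/negP => c2.
have C4p : 0 < cYYYY b := qpd_cXXXX_gt0 (qpd_swap bpd).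
have A4p := qpd_cXXXX_gt0 bpd.
have dt : 0 < cXXXX b * cYYYY b - m ^+ 2.
  have : 0 < qform b 0 0 0 (cYYYY b) (- m) by apply: bpd => -[_ _ _]; lra.
  have -> : qform b 0 0 0 (cYYYY b) (- m) = cYYYY b * (cXXXX b * cYYYY b - m ^+ 2).
    by rewrite /qform -/m; ring.
  by rewrite pmulr_rgt0.
have := ler_pM (mulr_ge0 (ltW Ap) (ltW C4p)) (mulr_ge0 (ltW Cp) (ltW A4p)) c c2.
have : 0 < cXX b * cYY b * (cXXXX b * cYYYY b - m ^+ 2) by rewrite !mulr_gt0.
lra.
Qed.

End BlockRemoval.

(** * Sequences satisfying XY + YX = 0 *)

Section AnticommutingSequences.
Variable R : realType.
Implicit Types (beta : word -> R) (b : quartic R).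

Definition quartic_of beta : quartic R :=
  Quartic (beta [::]) (beta [:: lX]) (beta [:: lY]) (beta [:: lX; lX]) (beta [:: lY; lY])
    (beta [:: lX; lX; lX]) (beta [:: lY; lY; lY])
    (beta [:: lX; lX; lX; lX]) (beta [:: lY; lY; lY; lY]) (beta [:: lX; lX; lY; lY]).

Definition anticommuting beta : Prop :=
  tracial_sequence beta /\
  [/\ beta [:: lX; lY] = 0, beta [:: lX; lX; lY] = 0, beta [:: lX; lY; lY] = 0,
      beta [:: lX; lX; lX; lY] = 0 & beta [:: lX; lY; lY; lY] = 0] /\
  beta [:: lX; lY; lX; lY] = - beta [:: lX; lX; lY; lY].

(** Up to length 4, letter counts determine the value, except that the two alternating words with
    two letters of each kind carry the opposite sign. *)
Definition canonical_value b (w : word) : R :=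
  let i := count (pred1 lX) w in let j := count (pred1 lY) w in
  if j == 0%N then nth 0 [:: c0 b; cX b; cXX b; cXXX b; cXXXX b] i
  else if i == 0%N then nth 0 [:: c0 b; cY b; cYY b; cYYY b; cYYYY b] j
  else if (i == 2%N) && (j == 2%N)
    then if (w == [:: lX; lY; lX; lY]) || (w == [:: lY; lX; lY; lX]) then - cXXYY b else cXXYY b
  else 0.

Lemma anticommuting_canonical beta w : anticommuting beta -> (size w <= 4)%N ->
  beta w = canonical_value (quartic_of beta) w.
Proof.
move=> [[tr _] [[h1 h2 h3 h4 h5] h6]].
have rt (k : nat) (u v : word) : (size u <= 4)%N -> v = rot k u -> beta u = beta v.
  by move=> su ->; apply/esym/tr; rewrite ?size_rot //; exists k.
case: w => [|[] [|[] [|[] [|[] [|e w]]]]] //= _; rewrite /canonical_value /= //;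
  by [ apply: etrans (rt 1%N _ [:: _] _ erefl) _
     | apply: etrans (rt 0%N _ _ _ erefl) _
     | apply: etrans (rt 1%N _ _ _ erefl) _
     | apply: etrans (rt 2%N _ _ _ erefl) _
     | apply: etrans (rt 3%N _ _ _ erefl) _ ].
Qed.

Lemma anticommuting_ext beta gamma : anticommuting beta -> anticommuting gamma ->
  quartic_of beta = quartic_of gamma -> forall w, (size w <= 4)%N -> beta w = gamma w.
Proof. move=> hb hg e w sw.
by rewrite (anticommuting_canonical hb sw) (anticommuting_canonical hg sw) e. Qed.

Definition vec7 (a0 a1 a2 a3 a4 a5 a6 : R) : 'cV[R]_7 :=
  \col_(i < 7) nth 0 [:: a0; a1; a2; a3; a4; a5; a6] i.

Lemma vec7E (v : 'cV[R]_7) : exists a0 a1 a2 a3 a4 a5 a6, v = vec7 a0 a1 a2 a3 a4 a5 a6.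
Proof.
exists (v (inord 0) 0), (v (inord 1) 0), (v (inord 2) 0), (v (inord 3) 0), (v (inord 4) 0),
  (v (inord 5) 0), (v (inord 6) 0).
apply/colP => -[i Hi]; rewrite mxE /=.
by case: i Hi => [|[|[|[|[|[|[|i]]]]]]] Hi //=; congr (v _ _); apply/val_inj; rewrite /= inordK.
Qed.

Lemma sum7E (V : nmodType) (F : 'I_7 -> V) : \sum_i F i =
  F (@Ordinal 7 0 isT) + F (@Ordinal 7 1 isT) + F (@Ordinal 7 2 isT) + F (@Ordinal 7 3 isT)
  + F (@Ordinal 7 4 isT) + F (@Ordinal 7 5 isT) + F (@Ordinal 7 6 isT).
Proof.
rewrite !big_ord_recl big_ord0 addr0 !addrA.
by do 6?[congr (_ + _)]; congr F; apply/val_inj.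
Qed.

Lemma quadratic_formE n (M : 'M[R]_n) (v : 'cV[R]_n) :
  (v^T *m M *m v) 0 0 = \sum_j \sum_i v i 0 * M i j * v j 0.
Proof.
rewrite mxE; apply: eq_bigr => j _; rewrite mxE mulr_suml.
by apply: eq_bigr => i _; rewrite mxE.
Qed.

(** The columns [XY] and [YX] decouple from the others, and their two-by-two part is [m] times the
    square of a difference. *)
Lemma moment_form beta a0 a1 a2 a3 a4 a5 a6 : anticommuting beta ->
  let v := vec7 a0 a1 a2 a3 a4 a5 a6 in
  (v^T *m moment_matrix beta *m v) 0 0 =
    qform (quartic_of beta) a0 a1 a2 a3 a6 + beta [:: lX; lX; lY; lY] * (a4 - a5) ^+ 2.
Proof.
move=> hb v; rewrite quadratic_formE.
under eq_bigr do under eq_bigr do rewrite 3!mxE.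
rewrite sum7E !sum7E /=.
have E w : (size w <= 4)%N -> beta w = canonical_value (quartic_of beta) w.
  exact: anticommuting_canonical.
rewrite ?(E [:: lY; lX]) ?(E [:: lX; lY]) ?(E [:: lY; lX; lX]) ?(E [:: lX; lY; lX]) //.
rewrite ?(E [:: lX; lX; lY]) ?(E [:: lY; lY; lX]) ?(E [:: lY; lX; lY]) ?(E [:: lX; lY; lY]) //.
rewrite ?(E [:: lY; lX; lX; lX]) ?(E [:: lX; lY; lX; lX]) ?(E [:: lX; lX; lY; lX]) //.
rewrite ?(E [:: lX; lX; lX; lY]) ?(E [:: lY; lY; lX; lX]) ?(E [:: lY; lX; lX; lY]) //.
rewrite ?(E [:: lX; lY; lY; lX]) ?(E [:: lX; lY; lX; lY]) ?(E [:: lY; lX; lY; lX]) //.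
rewrite ?(E [:: lY; lY; lX; lY]) ?(E [:: lY; lX; lY; lY]) ?(E [:: lX; lY; lY; lY]) //.
rewrite ?(E [:: lY; lY; lY; lX]) //.
by rewrite /canonical_value /qform /=; ring.
Qed.

End AnticommutingSequences.

(** * Trace sequences of symmetric pairs *)

Section TraceSequences.
Variable R : realType.

Lemma word_eval_nil t (A B : 'M[R]_t) : word_eval A B [::] = 1%:M.
Proof. by rewrite /word_eval big_nil. Qed.

Lemma word_eval_cons t (A B : 'M[R]_t) c w :
  word_eval A B (c :: w) = (if c == lX then A else B) *m word_eval A B w.
Proof. by rewrite /word_eval big_cons. Qed.

Lemma word_eval_cat t (A B : 'M[R]_t) u w :
  word_eval A B (u ++ w) = word_eval A B u *m word_eval A B w.
Proof.
by elim: u => [|c u IH]; rewrite ?word_eval_nil ?mul1mx //= !word_eval_cons IH mulmxA.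
Qed.

Lemma word_eval_rev t (A B : 'M[R]_t) w : A^T = A -> B^T = B ->
  word_eval A B (rev w) = (word_eval A B w)^T.
Proof.
move=> sA sB; elim: w => [|c w IH]; first by rewrite word_eval_nil trmx1.
rewrite rev_cons -cats1 word_eval_cat IH !word_eval_cons word_eval_nil mulmx1 trmx_mul.
by case: ifP; rewrite ?sA ?sB.
Qed.

Definition trace_seq t (A B : 'M[R]_t) (w : word) : R := ntrace (word_eval A B w).

Lemma trace_seq_tracial t (A B : 'M[R]_t) : A^T = A -> B^T = B ->
  tracial_sequence (trace_seq A B).
Proof.
move=> sA sB; split=> [v w _ _ [k ->]|w _]; rewrite /trace_seq /ntrace.
  by rewrite /rot word_eval_cat mxtrace_mulC -word_eval_cat cat_take_drop.
by rewrite word_eval_rev // mxtrace_tr.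
Qed.

Lemma mxtrace_anticomm t (S B : 'M[R]_t) : S *m B = - (B *m S) -> \tr (S *m B) = 0.
Proof.
move=> e; have : \tr (S *m B) = - \tr (S *m B) by rewrite {1}e linearN /= mxtrace_mulC.
lra.
Qed.

Lemma trace_seq_anticommuting t (A B : 'M[R]_t) : A^T = A -> B^T = B ->
  A *m B = - (B *m A) -> anticommuting (trace_seq A B).
Proof.
move=> sA sB AB; split; first exact: trace_seq_tracial.
have P (Z : 'M[R]_t) : A *m (B *m Z) = - (B *m (A *m Z)).
  by rewrite !mulmxA AB mulNmx.
have Q (Z : 'M[R]_t) : B *m (A *m Z) = - (A *m (B *m Z)) by rewrite P opprK.
rewrite /trace_seq /ntrace !word_eval_cons word_eval_nil /= !mulmx1.
have T (S Z : 'M[R]_t) : S *m Z = - (Z *m S) -> t%:R^-1 * \tr (S *m Z) = 0.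
  by move=> e; rewrite (mxtrace_anticomm e) mulr0.
split; first split.
- exact: T.
- rewrite mxtrace_mulC; apply: T.
  by rewrite -mulmxA (_ : B *m A = - (A *m B)) ?mulmxN // AB opprK.
- by rewrite mulmxA; apply: T; rewrite -mulmxA P.
- by rewrite !mulmxA; apply: T; rewrite -!mulmxA AB !mulmxN P mulmxN opprK P.
- by apply: T; rewrite P P AB !mulmxN opprK -!mulmxA.
- by rewrite Q mulmxN linearN /= mulrN.
Qed.

Lemma moment_form_trace t (A B : 'M[R]_t) (v : 'cV[R]_7) : A^T = A -> B^T = B ->
  let G := \sum_(i < 7) v i 0 *: word_eval A B (nth [::] basis2 i) in
  (v^T *m moment_matrix (trace_seq A B) *m v) 0 0 = ntrace (G^T *m G).
Proof.
move=> sA sB G; rewrite quadratic_formE /ntrace {2}/G mulmx_sumr linear_sum /= mulr_sumr.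
have GT : G^T = \sum_(i < 7) v i 0 *: (word_eval A B (nth [::] basis2 i))^T.
  by rewrite /G linear_sum; apply: eq_bigr => i _; rewrite linearZ.
apply: eq_bigr => j _; rewrite GT mulmx_suml linear_sum mulr_sumr /=.
apply: eq_bigr => i _; rewrite mxE /trace_seq /ntrace word_eval_cat word_eval_rev //.
by rewrite -scalemxAl -scalemxAr scalerA linearZ /=; ring.
Qed.

Lemma anticommuting_lin (k l : R) beta gamma : anticommuting beta -> anticommuting gamma ->
  anticommuting (fun w => k * beta w + l * gamma w).
Proof.
move=> [[b1 b2] [[b3 b4 b5 b6 b7] b8]] [[g1 g2] [[g3 g4 g5 g6 g7] g8]]; split; first split.
- by move=> v w sv sw e; rewrite (b1 _ _ sv sw e) (g1 _ _ sv sw e).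
- by move=> w sw; rewrite b2 // g2.
- by rewrite b3 b4 b5 b6 b7 b8 g3 g4 g5 g6 g7 g8; split; [split; ring | ring].
Qed.

Lemma moment_matrix_lin (k l : R) beta gamma :
  moment_matrix (fun w => k * beta w + l * gamma w)
    = k *: moment_matrix beta + l *: moment_matrix gamma.
Proof. by apply/matrixP => i j; rewrite !mxE. Qed.

Lemma mxtrace_gram_ge0 t m (S : 'M[R]_(t, m)) : 0 <= \tr (S^T *m S).
Proof.
rewrite /mxtrace sumr_ge0 // => i _; rewrite mxE sumr_ge0 // => j _.
by rewrite mxE -expr2 sqr_ge0.
Qed.

Lemma mxtrace_gram_eq0 t m (S : 'M[R]_(t, m)) : \tr (S^T *m S) = 0 -> S = 0.
Proof.
move=> e; apply/matrixP => i j; rewrite mxE.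
have pos k : true -> 0 <= (S^T *m S) k k.
  by move=> _; rewrite mxE sumr_ge0 // => l _; rewrite mxE -expr2 sqr_ge0.
have /eqP := @psumr_eq0P _ _ _ _ pos e j isT; rewrite mxE psumr_eq0; last first.
  by move=> l _; rewrite mxE -expr2 sqr_ge0.
by move=> /allP /(_ i (mem_index_enum _)); rewrite mxE mulf_eq0 orbb => /eqP.
Qed.

End TraceSequences.

(** * Anticommuting symmetric matrices *)

Section Projection.
Variables (R : realType) (n : nat).
Implicit Types (A B S Z P : 'M[R]_n.+1).

Lemma trmx_mulr A B : (A * B)^T = B^T * A^T.
Proof. exact: trmx_mul. Qed.

Lemma trmx_horner_mx S (p : {poly R}) : S^T = S -> (horner_mx S p)^T = horner_mx S p.
Proof.
move=> sS; elim/poly_ind: p => [|p c IH]; first by rewrite rmorph0 trmx0.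
rewrite rmorphD rmorphM /= horner_mx_X horner_mx_C linearD /= tr_scalar_mx trmx_mulr sS IH.
congr (_ + _); rewrite -{1}[S]horner_mx_X -{4}[S]horner_mx_X.
by rewrite -!rmorphM mulrC.
Qed.

(** A symmetric matrix has no nilpotent part: the Gram matrix of [S^(k+1) Z] contains the factor
    [S^(k+2) Z]. *)
Lemma sym_kernel_expr S Z k : S^T = S -> S ^+ k * Z = 0 -> S * Z = 0.
Proof.
move=> sS; have sX i : (S ^+ i)^T = S ^+ i.
  by elim: i => [|i IH]; rewrite ?expr0 ?trmx1 // exprS trmx_mulr IH sS -exprSr exprS.
elim: k => [|[|k] IH]; first by rewrite expr0 mul1r => ->; rewrite mulr0.
  by rewrite expr1.
move=> e; apply: IH; apply: mxtrace_gram_eq0.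
have -> : (S ^+ k.+1 * Z)^T *m (S ^+ k.+1 * Z) = Z^T * S ^+ k * (S ^+ k.+2 * Z).
  have h : S ^+ k.+1 * S ^+ k.+1 = S ^+ k * S ^+ k.+2 by rewrite -!exprD addSnnS.
  transitivity (Z^T * (S ^+ k.+1 * S ^+ k.+1) * Z).
    by rewrite trmx_mulr sX mulmxE -!mulrA.
  by rewrite h -!mulrA.
by rewrite e mulr0 linear0.
Qed.

(** Write the characteristic polynomial as [X^k g] with [g(0)] nonzero; then [S g(S) = 0], and
    [1 - g / g(0)] is divisible by [X]. Thus [S r(S)] is the projection onto the range of [S], and
    as a polynomial in [S] it inherits every commutation relation of [S]. *)
Lemma exists_poly_support_projection S : S^T = S ->
  exists r : {poly R}, S * (S * horner_mx S r) = S.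
Proof.
move=> sS; have p0 : char_poly S != 0 by rewrite monic_neq0 // char_poly_monic.
have [k [g]] := multiplicity_XsubC (char_poly S) 0; rewrite p0 /= => g0 e.
have CH := Cayley_Hamilton S; rewrite e mulrC rmorphM rmorphXn /= subr0 horner_mx_X in CH.
have SH := sym_kernel_expr sS CH.
have c0 : g.[0] != 0 by [].
pose h := 1 - g.[0]^-1 *: g.
have /factor_theorem [r hr] : root h 0.
  by rewrite /root /h !hornerE mulVf // subrr.
exists r; rewrite subr0 in hr.
have -> : S * horner_mx S r = 1 - g.[0]^-1 *: horner_mx S g.
  rewrite -{1}[S]horner_mx_X -rmorphM mulrC -hr /h rmorphB rmorph1 /=.
  by rewrite linearZ.
by rewrite mulrBr mulr1 -scalerAr SH scaler0 subr0.
Qed.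

(** The product can be rearranged as [A^3 B Z] times [B], and [A^3 B Z] anticommutes with [B]
    because it contains an odd number of factors [A]. *)
Lemma tr_anticomm_odd A B Z : A * B = - (B * A) -> GRing.comm Z A -> GRing.comm Z B ->
  \tr (A * A * (B * B) * Z * A) = 0.
Proof.
move=> AB ZA ZB.
have BA Y : B * (A * Y) = - (A * (B * Y)) by rewrite !mulrA AB mulNr opprK.
have BA0 : B * A = - (A * B) by rewrite AB opprK.
have ZB' Y : Z * (B * Y) = B * (Z * Y) by rewrite !mulrA ZB.
have ZA' Y : Z * (A * Y) = A * (Z * Y) by rewrite !mulrA ZA.
have -> : A * A * (B * B) * Z * A = (A * A * A * B * Z) *m B.
  rewrite mulmxE -!mulrA; do ![rewrite ?ZB ?ZB' ?ZA ?ZA' ?BA ?BA0 ?mulrN ?mulNr ?opprK].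
  by [].
apply: mxtrace_anticomm; rewrite !mulmxE -!mulrA.
by do ![rewrite ?ZB ?ZB' ?ZA ?ZA' ?BA ?BA0 ?mulrN ?mulNr ?opprK].
Qed.

Lemma anticomm_sqr A B : A * B = - (B * A) -> GRing.comm (A * A) B.
Proof.
move=> AB; rewrite /GRing.comm -mulrA AB mulrN [A * (B * A)]mulrA AB mulNr opprK.
by rewrite mulrA.
Qed.

(** [P] is [S * T] with [S = A^2 B^2] and [T] a polynomial in [S]; the explicit factor [A^2 B^2] is
    what lets the odd traces be cancelled. *)
Lemma anticomm_projection A B : A^T = A -> B^T = B -> A * B = - (B * A) ->
  exists P, [/\ P^T = P, P * P = P, GRing.comm P A & GRing.comm P B] /\
  [/\ P * (A * A * (B * B)) = A * A * (B * B),
      (forall Z, GRing.comm Z A -> GRing.comm Z B -> \tr (P * Z * A) = 0) &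
      (forall Z, GRing.comm Z A -> GRing.comm Z B -> \tr (P * Z * B) = 0)].
Proof.
move=> sA sB AB; pose S := A * A * (B * B).
have BA : B * A = - (A * B) by rewrite AB opprK.
have aB := anticomm_sqr AB.
have bA := anticomm_sqr BA.
have ab : A * A * (B * B) = B * B * (A * A) by apply: commrM.
have sS : S^T = S by rewrite /S trmx_mulr !trmx_mulr sA sB ab.
have SA : GRing.comm A S by apply: commrM; [exact: commrM | exact/commr_sym].
have SB : GRing.comm B S by apply: commrM; [exact/commr_sym | exact: commrM].
have [r hr] := exists_poly_support_projection sS.
pose T := horner_mx S r.
have TA : GRing.comm T A by apply/commr_sym; apply: (comm_mx_horner r SA).
have TB : GRing.comm T B by apply/commr_sym; apply: (comm_mx_horner r SB).
have TS : GRing.comm T S by apply/commr_sym; apply: (comm_mx_horner r (erefl (S *m S))).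
exists (S * T); split; split.
- by rewrite trmx_mulr sS trmx_horner_mx.
- by rewrite mulrA -[S * T * S]mulrA TS hr.
- by apply/commr_sym; apply: commrM => //; exact/commr_sym.
- by apply/commr_sym; apply: commrM => //; exact/commr_sym.
- by rewrite -/S -mulrA TS hr.
- move=> Z ZA ZB; rewrite -[S * T * Z]mulrA; apply: tr_anticomm_odd => //.
    by apply/commr_sym; apply: commrM; exact/commr_sym.
  by apply/commr_sym; apply: commrM; exact/commr_sym.
- move=> Z ZA ZB; rewrite -[S * T * Z]mulrA /S ab; apply: tr_anticomm_odd => //.
    by apply/commr_sym; apply: commrM; exact/commr_sym.
  by apply/commr_sym; apply: commrM; exact/commr_sym.
Qed.

(** The constants are the traces of [P] against products of [1], [A^2], [B^2]. Only the part under
    [P] is kept, where the odd terms drop out; since [P] fixes [A^2 B^2], the entry [k12] is not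
    diminished. *)
Lemma anticomm_trace_bound A B : A^T = A -> B^T = B -> A * B = - (B * A) ->
  exists k00 k01 k02 k11 k22, let k12 := \tr (A * A * (B * B)) in
  [/\ 0 <= k01, 0 <= k02, k01 = 0 -> k12 = 0 & k02 = 0 -> k12 = 0] /\
  (forall x y z, 0 <= k00 * x ^+ 2 + 2 * k01 * x * y + 2 * k02 * x * z
      + k11 * y ^+ 2 + 2 * k12 * y * z + k22 * z ^+ 2) /\
  (forall g0 g1 g2 g3 g4,
    let G := g0 *: 1 + g1 *: A + g2 *: B + g3 *: (A * A) + g4 *: (B * B) in
    k00 * g0 ^+ 2 + 2 * k01 * g0 * g3 + 2 * k02 * g0 * g4
      + k11 * g3 ^+ 2 + 2 * k12 * g3 * g4 + k22 * g4 ^+ 2 + k01 * g1 ^+ 2 + k02 * g2 ^+ 2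
      <= \tr (G^T * G)).
Proof.
move=> sA sB AB; have [P [[sP PP PA PB] [PS oA oB]]] := anticomm_projection sA sB AB.
pose a := A * A; pose c := B * B.
have BA : B * A = - (A * B) by rewrite AB opprK.
have aB : GRing.comm a B := anticomm_sqr AB.
have cA : GRing.comm c A := anticomm_sqr BA.
have aA : GRing.comm a A by rewrite /GRing.comm /a mulrA.
have cB : GRing.comm c B by rewrite /GRing.comm /c mulrA.
have ca : c * a = a * c by apply: commrM.
pose u x y z := x *: 1 + y *: a + z *: c : 'M[R]_n.+1.
have uA x y z : GRing.comm (u x y z) A.
  by rewrite /GRing.comm /u !mulrDl !mulrDr -!scalerAl -!scalerAr aA cA mul1r mulr1.
have uB x y z : GRing.comm (u x y z) B.
  by rewrite /GRing.comm /u !mulrDl !mulrDr -!scalerAl -!scalerAr aB cB mul1r mulr1.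
have su x y z : (u x y z)^T = u x y z.
  by rewrite /u !linearD !linearZ /= trmx1 /a /c !trmx_mulr sA sB.
have uE x y z : \tr (P * (u x y z * u x y z)) =
  \tr P * x ^+ 2 + 2 * \tr (P * a) * x * y + 2 * \tr (P * c) * x * z
  + \tr (P * (a * a)) * y ^+ 2 + 2 * \tr (a * c) * y * z + \tr (P * (c * c)) * z ^+ 2.
  rewrite /u !mulrDl !mulrDr -!scalerAl -!scalerAr !mulr1 !mul1r.
  rewrite -?scalerAr ca PS ?mulr1 !linearD !linearZ /=.
  by ring.
have PZZ Z : GRing.comm Z P -> Z^T = Z -> P * (Z * Z) = (P * Z)^T *m (P * Z).
  move=> ZP sZ; rewrite trmx_mulr sP sZ mulmxE -[Z * P * _]mulrA [P * (P * Z)]mulrA PP.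
  by rewrite [RHS]mulrA ZP mulrA.
have PZ Z : GRing.comm Z P -> Z^T = Z -> 0 <= \tr (P * (Z * Z)).
  by move=> ZP sZ; rewrite PZZ // mxtrace_gram_ge0.
have Pker Z : GRing.comm Z P -> Z^T = Z -> \tr (P * (Z * Z)) = 0 -> P * Z = 0.
  by move=> ZP sZ; rewrite PZZ //; exact: mxtrace_gram_eq0.
exists (\tr P), (\tr (P * a)), (\tr (P * c)), (\tr (P * (a * a))), (\tr (P * (c * c))) => k12.
have AP := commr_sym PA; have BP := commr_sym PB.
have aP : GRing.comm a P by apply/commr_sym/commrM.
have cP : GRing.comm c P by apply/commr_sym/commrM.
have uP x y z : GRing.comm (u x y z) P.
  by rewrite /GRing.comm /u !mulrDl !mulrDr -!scalerAl -!scalerAr aP cP mul1r mulr1.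
split; [split|split].
- exact: PZ.
- exact: PZ.
- by move=> /(Pker _ AP sA) e; rewrite /k12 -PS /a !mulrA e !mul0r linear0.
- by move=> /(Pker _ BP sB) e; rewrite /k12 -PS -[A * A]/a -[B * B]/c -ca /c !mulrA e !mul0r linear0.
- by move=> x y z; rewrite -uE; apply: PZ.
move=> g0 g1 g2 g3 g4; cbv zeta; set G := (X in X^T * X).
pose U := u g0 g3 g4; pose z := g1 *: A + g2 *: B.
have GE : G = U + z.
  by rewrite /G /U /u /z; apply/matrixP => i j; rewrite !mxE; ring.
have sz : z^T = z by rewrite /z linearD !linearZ /= sA sB.
have sG : G^T = G by rewrite GE linearD /= su sz.
have zz : z * z = g1 ^+ 2 *: a + g2 ^+ 2 *: c.
  rewrite /z mulrDl !mulrDr -!scalerAl -!scalerAr BA !scalerA !scalerN.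
  by rewrite [g2 * g1]mulrC addrA addrK -!expr2.
have Pz : GRing.comm z P by rewrite /GRing.comm /z mulrDl mulrDr -!scalerAl -!scalerAr AP BP.
have GP : GRing.comm G P by rewrite GE /GRing.comm mulrDl mulrDr uP Pz.
have tUz : \tr (P * (U * z)) = 0.
  rewrite mulrA /z mulrDr -!scalerAr linearD !linearZ /= (oA _ (uA _ _ _) (uB _ _ _)) (oB _ (uA _ _ _) (uB _ _ _)).
  by rewrite !mulr0 addr0.
have Uz : U * z = z * U.
  by rewrite /z [LHS]mulrDr [RHS]mulrDl -!scalerAr -!scalerAl uA uB.
have tP : \tr (P * (G * G)) = \tr (P * (U * U)) + \tr (P * a) * g1 ^+ 2 + \tr (P * c) * g2 ^+ 2.
  have -> : G * G = U * U + (U * z + U * z) + (g1 ^+ 2 *: a + g2 ^+ 2 *: c).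
    by rewrite GE (mulrDr (U + z) U z) !(mulrDl U z) -Uz zz !addrA.
  rewrite !(mulrDr P) -!scalerAr !linearD !linearZ /= tUz.
  by ring.
(* The part outside the range of [P] is a Gram matrix, and its trace can be discarded. *)
have -> : G^T * G = P * (G * G) + (G * (1 - P)) ^T *m (G * (1 - P)).
  rewrite sG trmx_mulr linearB /= trmx1 sP sG mulmxE.
  have -> : (1 - P) * G * (G * (1 - P)) = (1 - P) * (1 - P) * (G * G).
    have GP' : GRing.comm (G * G) (1 - P).
      by apply/commr_sym; apply: commrM; apply/commr_sym; apply: commrB => //; exact: commr1.
    by rewrite -!mulrA; congr (_ * _); rewrite !mulrA GP' mulrA.
  have -> : (1 - P) * (1 - P) = 1 - P.
    by rewrite mulrBr mulr1 mulrBl mul1r PP subrr subr0.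
  by rewrite mulrBl mul1r addrC subrK.
rewrite linearD /= tP uE -/k12.
by rewrite -[X in X <= _]addr0 lerD // mxtrace_gram_ge0.
Qed.
End Projection.

(** * Finitely atomic measures *)

Section FiniteMeasures.
Variable R : realType.

(** Constructions may produce repeated points and zero weights, whereas a measure demands distinct
    atoms and positive weights. *)
Lemma merge_weights (T : eqType) (s : seq (R * T)) : all (fun a => 0 <= a.1) s ->
  exists s' : seq (R * T), [/\ uniq (map snd s'), all (fun a => 0 < a.1) s' &
    forall F : T -> R, \sum_(a <- s) a.1 * F a.2 = \sum_(a <- s') a.1 * F a.2].
Proof.
elim: s => [|[w t] s IH] /=; first by exists [::].
case/andP => w0 /IH [s' [us' ps' E]].
have [w00|wn0] := eqVneq w 0.
  by exists s'; split=> // F; rewrite big_cons /= w00 mul0r add0r.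
exists ((w + \sum_(a <- s' | a.2 == t) a.1, t) :: [seq a <- s' | a.2 != t]); split.
- rewrite /= (subseq_uniq _ us') ?andbT; last by rewrite map_subseq ?filter_subseq.
  by apply/mapP => -[a]; rewrite mem_filter => /andP[/eqP ne _] /esym.
- rewrite /= ltr_wpDr ?lt_def ?wn0 //=; last first.
    rewrite big_seq_cond sumr_ge0 // => a /andP[/(allP ps')] /ltW ? _; exact.
  by apply/allP => a; rewrite mem_filter => /andP[_ /(allP ps')].
- move=> F; rewrite !big_cons /= E mulrDl -addrA; congr (_ + _).
  rewrite big_filter (bigID (fun a => a.2 == t)) /= mulr_suml; congr (_ + _).
  by apply: eq_bigr => a /eqP ->.
Qed.

Notation atomT := {classic atom R}.

Lemma measure_of_seq (s : seq (R * atomT)) : uniq (map snd s) ->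
  all (fun a => 0 < a.1) s -> \sum_(a <- s) a.1 = 1 ->
  exists mu : measure R,
    (forall F : atom R -> R,
       \sum_k weight mu k * F (atom_of mu k) = \sum_(a <- s) a.1 * F a.2) /\
    (forall i, natoms_of_size mu i = count (fun a => atom_size (a.2 : atom R) == i) s).
Proof.
move=> us ps s1; pose a k : R * atomT := tnth (in_tuple s) k.
have inj : injective (fun k : 'I_(size s) => (a k).2 : atom R).
  move=> i j; rewrite /a !(tnth_nth (0, (a i).2)) /= => e.
  apply/val_inj/eqP; rewrite -(nth_uniq (a i).2 _ _ us) ?size_map ?ltn_ord //.
  by rewrite !(nth_map (0, (a i).2)) ?ltn_ord //; apply/eqP; exact: e.
have pos k : 0 < (a k).1 by have := allP ps (a k); rewrite mem_tnth => ->.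
have sum1 : \sum_k (a k).1 = 1 by rewrite -s1 [RHS]big_tnth.
exists (Measure inj pos sum1); split=> [F|i]; first by rewrite [RHS]big_tnth.
by rewrite /natoms_of_size /= -sum1_card -sum1_count [RHS]big_tnth.
Qed.

Lemma trmx_scalar1 (x : R) : (x%:M : 'M_1)^T = x%:M.
Proof. exact: tr_scalar_mx. Qed.

Definition point_atom (x y : R) : atom R :=
  @Atom R 1 x%:M y%:M isT (trmx_scalar1 x) (trmx_scalar1 y).

Lemma mat2_sym (a b c : R) : (mat2 a b b c)^T = mat2 a b b c.
Proof.
by apply/matrixP => i j; rewrite !mxE; case: i j => [[|[|i]] Hi] [[|[|j]] Hj].
Qed.

Definition block_X (al : R) : 'M[R]_2 := mat2 (Num.sqrt al^-1) 0 0 (- Num.sqrt al^-1).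
Definition block_Y (ga : R) : 'M[R]_2 := mat2 0 (Num.sqrt ga^-1) (Num.sqrt ga^-1) 0.

Definition block_atom (al ga : R) : atom R :=
  @Atom R 2 (block_X al) (block_Y ga) isT (mat2_sym _ _ _) (mat2_sym _ _ _).

Lemma trace_seq_point (x y : R) w :
  trace_seq (x%:M : 'M_1) y%:M w = x ^+ count (pred1 lX) w * y ^+ count (pred1 lY) w.
Proof.
rewrite /trace_seq /ntrace invr1 mul1r.
have -> : word_eval (x%:M : 'M_1) y%:M w = (x ^+ count (pred1 lX) w * y ^+ count (pred1 lY) w)%:M.
  elim: w => [|c w IH]; first by rewrite word_eval_nil mulr1.
  rewrite word_eval_cons IH.
  by case: c => /=; rewrite -scalar_mxM; congr (_%:M); rewrite ?add0n ?add1n exprS; ring.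
by rewrite mxtrace_scalar.
Qed.

Lemma mat2_mul (a b c d a' b' c' d' : R) : mat2 a b c d *m mat2 a' b' c' d' =
  mat2 (a * a' + b * c') (a * b' + b * d') (c * a' + d * c') (c * b' + d * d').
Proof.
apply/matrixP => i j; rewrite !mxE !big_ord_recl big_ord0 !mxE /= addr0.
by case: i j => [[|[|i]] Hi] [[|[|j]] Hj].
Qed.

Lemma mat2_tr (a b c d : R) : \tr (mat2 a b c d) = a + d.
Proof. by rewrite /mxtrace !big_ord_recl big_ord0 !mxE /= addr0. Qed.

Lemma mat2_1 : 1%:M = mat2 1 0 0 1 :> 'M[R]_2.
Proof. by apply/matrixP => -[[|[|i]] Hi] [[|[|j]] Hj]; rewrite !mxE. Qed.

Lemma mat2_opp (a b c d : R) : - mat2 a b c d = mat2 (- a) (- b) (- c) (- d).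
Proof. by apply/matrixP => -[[|[|i]] Hi] [[|[|j]] Hj]; rewrite !mxE. Qed.

Definition block_seq (al ga : R) := trace_seq (block_X al) (block_Y ga).

Lemma block_seq_anticommuting al ga : anticommuting (block_seq al ga).
Proof.
apply: trace_seq_anticommuting; rewrite ?mat2_sym // /block_X /block_Y !mat2_mul mat2_opp.
by congr mat2; ring.
Qed.

Lemma block_quartic (al ga : R) : 0 < al -> 0 < ga ->
  quartic_of (block_seq al ga) =
    Quartic 1 0 0 al^-1 ga^-1 0 0 (al^-1 ^+ 2) (ga^-1 ^+ 2) (al^-1 * ga^-1).
Proof.
move=> ap gp; have hs : Num.sqrt al^-1 * Num.sqrt al^-1 = al^-1.
  by rewrite -expr2 sqr_sqrtr // invr_ge0 ltW.
have ht : Num.sqrt ga^-1 * Num.sqrt ga^-1 = ga^-1.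
  by rewrite -expr2 sqr_sqrtr // invr_ge0 ltW.
rewrite /quartic_of /block_seq /trace_seq /ntrace !word_eval_cons word_eval_nil /= mat2_1.
rewrite /block_X /block_Y; move: (Num.sqrt _) (Num.sqrt _) hs ht => s t hs ht.
rewrite !mat2_mul !mat2_tr -hs -ht.
by congr Quartic; field.
Qed.

Lemma anticommuting_sum (T : Type) (s : seq (R * T)) (f : T -> word -> R) :
  (forall t, anticommuting (f t)) -> anticommuting (fun w => \sum_(a <- s) a.1 * f a.2 w).
Proof.
move=> hf; elim: s => [|[k t] s IH].
  have -> : (fun w => \sum_(a <- [::]) a.1 * f a.2 w) = (fun w => 0).
    by apply/funext => w; rewrite big_nil.
  by split; [split | split; [split | rewrite oppr0]].
have -> : (fun w => \sum_(a <- (k, t) :: s) a.1 * f a.2 w) =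
    (fun w => k * f t w + 1 * \sum_(a <- s) a.1 * f a.2 w).
  by apply/funext => w; rewrite big_cons mul1r.
exact: anticommuting_lin.
Qed.

Lemma point_seq_anticommuting (x y : R) : x * y = 0 ->
  anticommuting (trace_seq (x%:M : 'M_1) y%:M).
Proof.
move=> xy; apply: trace_seq_anticommuting; rewrite ?trmx_scalar1 //.
by rewrite -!scalar_mxM [y * x]mulrC xy !raddf0.
Qed.

End FiniteMeasures.

(** * Moment matrices *)

Section MomentMatrices.
Variable R : realType.
Implicit Types (beta : word -> R) (b : quartic R) (al ga : R).

Lemma word_colE (M : 'M[R]_7) w (k : 'I_7) : index w basis2 = k -> word_col M w = col k M.
Proof. by move=> e; rewrite /word_col e inord_val. Qed.

Lemma relation_anticommuting beta : tracial_sequence beta ->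
  word_col (moment_matrix beta) [:: lX; lY] + word_col (moment_matrix beta) [:: lY; lX] = 0 ->
  anticommuting beta.
Proof.
move=> tb; rewrite (@word_colE _ _ (@Ordinal 7 4 isT)) // (@word_colE _ _ (@Ordinal 7 5 isT)) //.
move=> /matrixP H; have [tr _] := tb.
have rt (k : nat) (u v : word) : (size u <= 4)%N -> v = rot k u -> beta u = beta v.
  by move=> su ->; apply/esym/tr; rewrite ?size_rot //; exists k.
have := H (@Ordinal 7 0 isT) 0; have := H (@Ordinal 7 1 isT) 0.
have := H (@Ordinal 7 2 isT) 0; have := H (@Ordinal 7 3 isT) 0.
have := H (@Ordinal 7 4 isT) 0; have := H (@Ordinal 7 6 isT) 0.
rewrite !mxE /= => h6 h4 h3 h2 h1 h0; split=> //; split.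
  split.
  - by move: h0; rewrite (rt 1%N [:: lY; lX] [:: lX; lY]) //; lra.
  - by move: h1; rewrite (rt 2%N [:: lX; lY; lX] [:: lX; lX; lY]) //; lra.
  - move: h2; rewrite (rt 1%N [:: lY; lX; lY] [:: lX; lY; lY]) //.
    by rewrite (rt 2%N [:: lY; lY; lX] [:: lX; lY; lY]) //; lra.
  - by move: h3; rewrite (rt 3%N [:: lX; lX; lY; lX] [:: lX; lX; lX; lY]) //; lra.
  - move: h6; rewrite (rt 2%N [:: lY; lY; lX; lY] [:: lX; lY; lY; lY]) //.
    by rewrite (rt 3%N [:: lY; lY; lY; lX] [:: lX; lY; lY; lY]) //; lra.
- move: h4; rewrite (rt 1%N [:: lY; lX; lX; lY] [:: lX; lX; lY; lY]) //.
  by rewrite (rt 1%N [:: lY; lX; lY; lX] [:: lX; lY; lX; lY]) //; lra.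
Qed.

Lemma size_basis2 (i : 'I_7) : (size (nth [::] basis2 i) <= 2)%N.
Proof. by case: i => [[|[|[|[|[|[|[|i]]]]]]] Hi]. Qed.

Lemma moment_matrix_sym beta : tracial_sequence beta -> (moment_matrix beta)^T = moment_matrix beta.
Proof.
move=> [_ rv]; apply/matrixP => i j; rewrite !mxE rv ?rev_cat ?revK //.
by rewrite size_cat size_rev (leq_add (size_basis2 j) (size_basis2 i)).
Qed.

Lemma psd_momentP beta : anticommuting beta ->
  psd (moment_matrix beta) <-> qpsd (quartic_of beta) /\ 0 <= beta [:: lX; lX; lY; lY].
Proof.
move=> ab; split=> [[_ H]|[H m0]]; first split.
- move=> g0 g1 g2 g3 g4; have := H (vec7 g0 g1 g2 g3 0 0 g4).
  by rewrite moment_form // subrr expr0n mulr0 addr0.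
- have := H (vec7 0 0 0 0 1 0 0); rewrite moment_form // subr0 expr1n mulr1.
  by rewrite /qform !expr0n /= !(mulr0, mul0r, addr0, add0r).
- split=> [|v]; first by apply: moment_matrix_sym; case: ab.
  have [a0 [a1 [a2 [a3 [a4 [a5 [a6 ->]]]]]]] := vec7E v.
  by rewrite moment_form // addr_ge0 // mulr_ge0 ?sqr_ge0.
Qed.

(** Perturbing [v] along each coordinate vector turns isotropy into membership in the kernel. *)
Lemma psd_kernel n (M : 'M[R]_n) (v : 'cV[R]_n) :
  psd M -> (v^T *m M *m v) 0 0 = 0 -> M *m v = 0.
Proof.
move=> [sM H] v0; apply/colP => i; rewrite [RHS]mxE.
pose w : 'cV[R]_n := delta_mx i 0.
have wM : (w^T *m M *m v) 0 0 = (M *m v) i 0.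
  by rewrite -mulmxA trmx_delta -rowE mxE.
have vM : (v^T *m M *m w) 0 0 = (M *m v) i 0.
  have -> : v^T *m M *m w = (w^T *m M *m v)^T by rewrite !trmx_mul trmxK sM mulmxA.
  by rewrite mxE wM.
have : 2 * (M *m v) i 0 = 0; last by lra.
apply: (@linear_nonneg R ((w^T *m M *m w) 0 0) _ ((v^T *m M *m v) 0 0)) => // t.
have := H (v + t *: w); congr (_ <= _).
have -> : (v + t *: w)^T = v^T + t *: w^T by rewrite linearD linearZ.
rewrite !mulmxDl !mulmxDr -!scalemxAl -!scalemxAr.
rewrite -wM; move: vM; rewrite -wM; move: (v^T *m M *m w) (w^T *m M *m v) => P Q e.
by rewrite !mxE e; ring.
Qed.

Lemma rank_ge6_kernel (M : 'M[R]_7) (u v : 'cV[R]_7) : M^T = M -> (6 <= \rank M)%N ->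
  u != 0 -> M *m u = 0 -> M *m v = 0 -> exists c, v = c *: u.
Proof.
move=> sM rM un Mu Mv.
have ker (w : 'cV[R]_7) : M *m w = 0 -> (w^T <= kermx M)%MS.
  by move=> Mw; apply/sub_kermxP; rewrite -{1}sM -trmx_mul Mw trmx0.
have := ker _ Mv; suff /eqmxP e : (u^T == kermx M)%MS.
  by rewrite -e => /sub_rVP [c e']; exists c; rewrite -[v]trmxK e' linearZ /= trmxK.
have := mxrank_leqif_eq (ker _ Mu); rewrite /leqif => -[le <-]; rewrite eqn_leq le /=.
rewrite mxrank_ker rank_rV trmx_eq0 un; have := rank_leq_row M; lia.
Qed.

Lemma vec7_neq0 (a0 a1 a2 a3 a4 a5 a6 : R) (i : 'I_7) :
  nth 0 [:: a0; a1; a2; a3; a4; a5; a6] i != 0 -> vec7 a0 a1 a2 a3 a4 a5 a6 != 0.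
Proof. by apply: contra_neq => /colP /(_ i); rewrite !mxE. Qed.

(** Rank 6 leaves a kernel of dimension one, already spanned by [XY + YX], so no other isotropic
    vector remains. *)
Lemma rank6_qpd beta : anticommuting beta -> nc_condition beta ->
  psd (moment_matrix beta) -> \rank (moment_matrix beta) = 6%N ->
  0 < beta [:: lX; lX; lY; lY] /\ qpd (quartic_of beta).
Proof.
move=> ab nc pM rM; have [H m0] := (psd_momentP ab).1 pM; split.
  rewrite lt_def m0 andbT; apply/eqP => mz; apply: nc.
  by case: ab => _ [_ ->]; rewrite mz oppr0.
move=> g0 g1 g2 g3 g4 ne; rewrite lt_def H andbT; apply/eqP => gz.
pose v := vec7 g0 g1 g2 g3 0 0 g4; pose u : 'cV[R]_7 := vec7 0 0 0 0 1 1 0.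
have Mv : moment_matrix beta *m v = 0.
  by apply: psd_kernel => //; rewrite moment_form // gz subrr expr0n mulr0 addr0.
have Mu : moment_matrix beta *m u = 0.
  apply: psd_kernel => //; rewrite moment_form // subrr expr0n.
  by rewrite /qform !expr0n /= !(mulr0, mul0r, addr0, add0r).
have un : u != 0 by apply: (@vec7_neq0 _ _ _ _ _ _ _ (@Ordinal 7 4 isT)); rewrite /= oner_eq0.
have [] := rank_ge6_kernel _ _ un Mu Mv; rewrite ?rM //.
  by apply: moment_matrix_sym; case: ab.
move=> c /colP e; have := e (@Ordinal 7 4 isT); rewrite !mxE /= mulr1 => c0.
apply: ne; rewrite -c0 in e.
have z k : v k 0 = 0 by rewrite e !mxE mul0r.
split; [move: (z (@Ordinal 7 0 isT)) | move: (z (@Ordinal 7 1 isT)) | move: (z (@Ordinal 7 2 isT))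
  | move: (z (@Ordinal 7 3 isT)) | move: (z (@Ordinal 7 6 isT))]; by rewrite mxE.
Qed.

(** The factor 1 gives the linear combination the shape expected by [anticommuting_lin] and
    [moment_matrix_lin]. *)
Definition block_removed beta al ga (w : word) : R :=
  1 * beta w + (- (beta [:: lX; lX; lY; lY] * al * ga)) * block_seq al ga w.

Lemma block_removed_anticommuting beta al ga :
  anticommuting beta -> anticommuting (block_removed beta al ga).
Proof. by move=> ab; apply: anticommuting_lin => //; apply: block_seq_anticommuting. Qed.

Lemma quartic_block_removed beta al ga : 0 < al -> 0 < ga ->
  quartic_of (block_removed beta al ga) = remove_block (quartic_of beta) al ga.
Proof.
move=> ap gp; have := block_quartic ap gp; rewrite /quartic_of /block_removed.
case=> -> -> -> -> -> -> -> -> -> ->; rewrite /remove_block /=.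
by congr Quartic; field; rewrite ?gt_eqF.
Qed.

Lemma moment_block_removed beta al ga :
  moment_matrix (block_removed beta al ga) = moment_matrix beta
    - (beta [:: lX; lX; lY; lY] * al * ga) *: pair_moment_matrix (block_X al) (block_Y ga).
Proof. by rewrite moment_matrix_lin scale1r scaleNr. Qed.

(* Positivity of the reduced matrix makes the matrices on the segment before it
   positive combinations of it and [moment_matrix beta], so their rank cannot drop. *)
Lemma block_smallest_rank_drop beta al ga : anticommuting beta ->
  0 < beta [:: lX; lX; lY; lY] -> psd (moment_matrix beta) ->
  \rank (moment_matrix beta) = 6%N -> 0 < al -> 0 < ga ->
  psd (moment_matrix (block_removed beta al ga)) ->
  smallest_rank_drop (moment_matrix beta) (pair_moment_matrix (block_X al) (block_Y ga))
    (beta [:: lX; lX; lY; lY] * al * ga).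
Proof.
move=> ab mp pM rM ap gp pB; set xi := _ * al * ga; have xip : 0 < xi by rewrite !mulr_gt0.
have ac := block_removed_anticommuting al ga ab.
have qz : beta [:: lX; lX; lY; lY] - xi * block_seq al ga [:: lX; lX; lY; lY] = 0.
  have := f_equal (@cXXYY R) (quartic_block_removed beta ap gp); rewrite /= /block_removed.
  by rewrite -/xi; lra.
have MB := moment_block_removed beta al ga; rewrite -/xi in MB.
split=> //; rewrite rM -?MB.
  rewrite ltnNge; apply/negP => r6.
  (* Once the moment of [X^2 Y^2] is gone, [XY] and [YX] lie in the kernel separately, which is
     incompatible with rank 6. *)
  have ker a4 a5 : moment_matrix (block_removed beta al ga) *m vec7 0 0 0 0 a4 a5 0 = 0.
    apply: psd_kernel => //; rewrite moment_form //.
    have -> : block_removed beta al ga [:: lX; lX; lY; lY] = 0 by rewrite /block_removed -/xi; lra.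
    by rewrite /qform !expr0n /= !(mulr0, mul0r, addr0, add0r).
  have un : vec7 0 0 0 0 1 0 0 != 0 :> 'cV[R]_7.
    by apply: (@vec7_neq0 _ _ _ _ _ _ _ (@Ordinal 7 4 isT)); rewrite /= oner_eq0.
  have [] := rank_ge6_kernel _ r6 un (ker 1 0) (ker 0 1).
    by apply: moment_matrix_sym; case: ac.
  move=> c /colP /(_ (@Ordinal 7 5 isT)); rewrite !mxE /= mulr0 => /eqP.
  by rewrite oner_eq0.
move=> eta etap; set P := moment_matrix beta - _.
rewrite leNgt; apply: contraTN => lt; rewrite -leqNgt.
apply: leq_trans (_ : (\rank (moment_matrix beta) <= _)%N); first by rewrite rM.
have E (v : 'cV[R]_7) : (v^T *m P *m v) 0 0 = (1 - eta / xi) * (v^T *m moment_matrix beta *m v) 0 0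
    + eta / xi * (v^T *m moment_matrix (block_removed beta al ga) *m v) 0 0.
  rewrite MB /P !mulmxBr !mulmxBl -!scalemxAr -!scalemxAl.
  move: (v^T *m _ *m v) (v^T *m pair_moment_matrix _ _ *m v) => U V.
  by rewrite !mxE; field; rewrite gt_eqF.
have t1 : 0 < 1 - eta / xi by rewrite subr_gt0 ltr_pdivrMr // mul1r.
have t0 : 0 < eta / xi by rewrite divr_gt0.
(* A sum of two nonnegative values is zero only if both are, and the coefficient of the original
   form is positive. *)
have K : (kermx P <= kermx (moment_matrix beta))%MS.
  apply/sub_kermxP/row_matrixP => i; rewrite row_mul row0.
  have uP : row i (kermx P) *m P = 0 by apply/sub_kermxP/row_sub.
  move: (row i _) uP => u uP.
  have := E u^T; rewrite trmxK uP mul0mx mxE => z.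
  have y1 := pM.2 u^T; have y2 := pB.2 u^T; rewrite trmxK in y1 y2.
  have : moment_matrix beta *m u^T = 0.
    apply: psd_kernel => //; rewrite trmxK.
    have y3 := mulr_ge0 (ltW t0) y2.
    apply/eqP; rewrite -(mulrI_eq0 _ (mulfI (lt0r_neq0 t1))); apply/eqP.
    have := mulr_ge0 (ltW t1) y1; lra.
  by move=> /(f_equal trmx); rewrite trmx_mul trmxK trmx0 pM.1.
have := mxrankS K; rewrite !mxrank_ker; have := rank_leq_row P; have := rank_leq_row (moment_matrix beta).
lia.
Qed.

End MomentMatrices.

(** * Representing measures and their moment forms *)

Section RepresentingMeasures.
Variable R : realType.
Implicit Types (beta : word -> R) (b : quartic R) (al ga : R) (mu : measure R).

Notation atomT := {classic atom R}.
Definition atom_seq (t : atom R) : word -> R := trace_seq (atom_X t) (atom_Y t).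

Lemma atom_seq_nil t : atom_seq t [::] = 1.
Proof.
rewrite /atom_seq /trace_seq /ntrace word_eval_nil mxtrace1 mulVf //.
by rewrite pnatr_eq0 -lt0n atom_size_gt0.
Qed.

Lemma represents_of_seq beta (s : seq (R * atomT)) : normalized beta ->
  all (fun a => 0 <= a.1) s ->
  (forall w, (size w <= 4)%N -> beta w = \sum_(a <- s) a.1 * atom_seq a.2 w) ->
  exists mu, represents mu beta.
Proof.
move=> b1 s0 E; have [s' [us ps E']] := merge_weights s0.
have [|mu [Hmu _]] := measure_of_seq us ps.
  transitivity (\sum_(a <- s) a.1 * atom_seq a.2 [::]).
    by rewrite (E' (fun t => atom_seq t [::])); apply: eq_bigr => a _; rewrite atom_seq_nil mulr1.
  by rewrite -E.
by exists mu => w sw; rewrite E // (E' (fun t => atom_seq t w)) -(Hmu (fun t => atom_seq t w)).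
Qed.

Lemma sum_points_x (s : seq (R * R)) w :
  \sum_(a <- s) a.1 * trace_seq (a.2%:M : 'M_1) 0%:M w
    = pmoment s (count (pred1 lX) w) * 0 ^+ count (pred1 lY) w.
Proof.
by rewrite /pmoment mulr_suml; apply: eq_bigr => a _; rewrite trace_seq_point mulrA.
Qed.

Lemma sum_points_y (s : seq (R * R)) w :
  \sum_(a <- s) a.1 * trace_seq (0%:M : 'M_1) a.2%:M w
    = pmoment s (count (pred1 lY) w) * 0 ^+ count (pred1 lX) w.
Proof.
rewrite /pmoment mulr_suml; apply: eq_bigr => a _; rewrite trace_seq_point.
by ring.
Qed.

Definition axes_seq (w0 : R) (sx sy : seq (R * R)) (w : word) : R :=
  w0 * trace_seq (0%:M : 'M_1) 0%:M w +
  1 * (1 * (\sum_(a <- sx) a.1 * trace_seq (a.2%:M : 'M_1) 0%:M w)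
    + 1 * (\sum_(a <- sy) a.1 * trace_seq (0%:M : 'M_1) a.2%:M w)).

Lemma axes_seq_anticommuting w0 sx sy : anticommuting (axes_seq w0 sx sy).
Proof.
apply: anticommuting_lin; first by apply: point_seq_anticommuting; rewrite mulr0.
apply: anticommuting_lin.
  apply: (@anticommuting_sum R R sx (fun x => trace_seq (x%:M : 'M_1) 0%:M)) => x.
  by apply: point_seq_anticommuting; rewrite mulr0.
apply: (@anticommuting_sum R R sy (fun y => trace_seq (0%:M : 'M_1) y%:M)) => y.
by apply: point_seq_anticommuting; rewrite mul0r.
Qed.

Lemma axes_rep_seq beta al ga w0 sx sy : anticommuting beta -> 0 < al -> 0 < ga ->
  axes_rep_by (remove_block (quartic_of beta) al ga) w0 sx sy ->
  forall w, (size w <= 4)%N -> block_removed beta al ga w = axes_seq w0 sx sy w.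
Proof.
move=> ab ap gp [_ [e0 [x1 x2 x3 x4] [y1 y2 y3 y4] z]].
apply: anticommuting_ext.
- exact: block_removed_anticommuting.
- exact: axes_seq_anticommuting.
rewrite quartic_block_removed // /quartic_of /axes_seq !sum_points_x !sum_points_y !trace_seq_point.
move: e0 x1 x2 x3 x4 y1 y2 y3 y4 z; rewrite /remove_block /=.
by move=> -> <- <- <- <- <- <- <- <- _; congr Quartic; ring.
Qed.

Definition block_axes_atoms (m al ga w0 : R) (sx sy : seq (R * R)) : seq (R * atomT) :=
  (m * al * ga, block_atom al ga) :: (w0, point_atom 0 0)
  :: [seq (a.1, point_atom a.2 0) | a <- sx] ++ [seq (a.1, point_atom 0 a.2) | a <- sy].

Lemma axes_rep_atoms beta al ga w0 sx sy : anticommuting beta -> 0 < al -> 0 < ga ->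
  axes_rep_by (remove_block (quartic_of beta) al ga) w0 sx sy ->
  forall w, (size w <= 4)%N -> beta w =
    \sum_(a <- block_axes_atoms (beta [:: lX; lX; lY; lY]) al ga w0 sx sy) a.1 * atom_seq a.2 w.
Proof.
move=> ab ap gp rep w sw; rewrite !big_cons big_cat !big_map /=.
have := axes_rep_seq ab ap gp rep sw.
rewrite /block_removed /axes_seq /atom_seq /block_seq /=; lra.
Qed.

Lemma axes_rep_represents beta al ga : anticommuting beta -> normalized beta ->
  0 < beta [:: lX; lX; lY; lY] -> 0 < al -> 0 < ga ->
  axes_rep (remove_block (quartic_of beta) al ga) -> exists mu, represents mu beta.
Proof.
move=> ab b1 mp ap gp [w0 [sx [sy rep]]].
apply: represents_of_seq b1 _ (axes_rep_atoms ab ap gp rep).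
case: rep => -[w00 ax ay] _; rewrite /= w00 !mulr_ge0 ?ltW //= all_cat !all_map.
by apply/andP.
Qed.

Lemma represents_form beta mu (v : 'cV[R]_7) : represents mu beta ->
  (v^T *m moment_matrix beta *m v) 0 0 = \sum_k weight mu k *
    (v^T *m moment_matrix (atom_seq (atom_of mu k)) *m v) 0 0.
Proof.
move=> H; rewrite quadratic_formE.
under [RHS]eq_bigr do rewrite quadratic_formE mulr_sumr.
rewrite [RHS]exchange_big /=; apply: eq_bigr => j _.
under [RHS]eq_bigr do rewrite mulr_sumr.
rewrite [RHS]exchange_big /=; apply: eq_bigr => i _.
rewrite mxE H ?mulr_sumr ?mulr_suml; last first.
  by rewrite size_cat size_rev (leq_add (size_basis2 i) (size_basis2 j)).
by apply: eq_bigr => k _; rewrite mxE /atom_seq /trace_seq; ring.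
Qed.

Lemma atom_form (t : atom R) (v : 'cV[R]_7) :
  let G := \sum_(i < 7) v i 0 *: word_eval (atom_X t) (atom_Y t) (nth [::] basis2 i) in
  (v^T *m moment_matrix (atom_seq t) *m v) 0 0 = (atom_size t)%:R^-1 * \tr (G^T *m G).
Proof. exact: moment_form_trace (atom_X_sym t) (atom_Y_sym t). Qed.

Lemma atom_form_ge0 (t : atom R) (v : 'cV[R]_7) :
  0 <= (v^T *m moment_matrix (atom_seq t) *m v) 0 0.
Proof. by rewrite atom_form mulr_ge0 ?invr_ge0 ?ler0n // mxtrace_gram_ge0. Qed.

Lemma represents_psd beta mu : tracial_sequence beta -> represents mu beta ->
  psd (moment_matrix beta).
Proof.
move=> tb H; split=> [|v]; first exact: moment_matrix_sym.
rewrite (represents_form _ H) sumr_ge0 // => k _.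
by rewrite mulr_ge0 ?atom_form_ge0 // ltW // weight_gt0.
Qed.

(** The form of [beta] vanishes at [XY + YX] and is a positive combination of the nonnegative forms
    of the atoms, so the square of [AB + BA] has trace zero in each. *)
Lemma represents_anticomm beta mu k : anticommuting beta -> represents mu beta ->
  atom_X (atom_of mu k) *m atom_Y (atom_of mu k)
    = - (atom_Y (atom_of mu k) *m atom_X (atom_of mu k)).
Proof.
move=> ab H; pose v : 'cV[R]_7 := vec7 0 0 0 0 1 1 0.
have := represents_form v H; rewrite moment_form // subrr expr0n mulr0 addr0.
rewrite /qform !expr0n /= !(mulr0, mul0r, addr0, add0r) => /esym e.
have pos i : true -> 0 <= weight mu i * (v^T *m moment_matrix (atom_seq (atom_of mu i)) *m v) 0 0.
  by move=> _; rewrite mulr_ge0 ?atom_form_ge0 // ltW // weight_gt0.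
have /eqP := @psumr_eq0P _ _ _ _ pos e k isT.
rewrite mulf_eq0 gt_eqF ?weight_gt0 //= atom_form mulf_eq0 invr_eq0 pnatr_eq0.
rewrite -leqn0 leqNgt atom_size_gt0 /= => /eqP /mxtrace_gram_eq0.
rewrite sum7E !mxE /= !scale0r !scale1r !add0r addr0 !word_eval_cons word_eval_nil /= !mulmx1.
by move=> /eqP; rewrite addr_eq0 => /eqP.
Qed.

(** The constants are packed into a tuple so that [choice] can select them for all atoms at once. *)
Lemma atom_trace_bound (t : atom R) : atom_X t *m atom_Y t = - (atom_Y t *m atom_X t) ->
  exists c : R * R * R * R * R, let: (k00, k01, k02, k11, k22) := c in
  let k12 := atom_seq t [:: lX; lX; lY; lY] in
  [/\ 0 <= k01, 0 <= k02, k01 = 0 -> k12 = 0 & k02 = 0 -> k12 = 0] /\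
  (forall x y z, 0 <= k00 * x ^+ 2 + 2 * k01 * x * y + 2 * k02 * x * z
      + k11 * y ^+ 2 + 2 * k12 * y * z + k22 * z ^+ 2) /\
  (forall g0 g1 g2 g3 g4, let v := vec7 g0 g1 g2 g3 0 0 g4 in
    k00 * g0 ^+ 2 + 2 * k01 * g0 * g3 + 2 * k02 * g0 * g4
      + k11 * g3 ^+ 2 + 2 * k12 * g3 * g4 + k22 * g4 ^+ 2 + k01 * g1 ^+ 2 + k02 * g2 ^+ 2
      <= (v^T *m moment_matrix (atom_seq t) *m v) 0 0).
Proof.
case: t => -[//|n] A B sp sA sB /= AB; set t := Atom _ _ _.
have [k00 [k01 [k02 [k11 [k22 [[k1 k2 k3 k4] [K H]]]]]]] := anticomm_trace_bound sA sB AB.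
pose c : R := n.+1%:R^-1; have cp : 0 < c by rewrite invr_gt0 ltr0n.
have e12 : atom_seq t [:: lX; lX; lY; lY] = c * \tr (A * A * (B * B)).
  rewrite /atom_seq /trace_seq /ntrace /= !word_eval_cons word_eval_nil /= mulmx1.
  by rewrite mulmxA.
exists (c * k00, c * k01, c * k02, c * k11, c * k22); rewrite e12; split.
  split; rewrite ?mulr_ge0 ?(ltW cp) //.
    by move=> /eqP; rewrite mulf_eq0 gt_eqF //= => /eqP /k3 ->; rewrite mulr0.
  by move=> /eqP; rewrite mulf_eq0 gt_eqF //= => /eqP /k4 ->; rewrite mulr0.
split=> [x y z|g0 g1 g2 g3 g4].
  by have := mulr_ge0 (ltW cp) (K x y z); congr (_ <= _); ring.
cbv zeta; rewrite atom_form /= sum7E !mxE /= !word_eval_cons word_eval_nil /= !mulmx1.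
have := ler_wpM2l (ltW cp) (H g0 g1 g2 g3 g4).
rewrite !scale0r !addr0; congr (_ <= _); ring.
Qed.

(** The bounds are averaged over the atoms. The averages of [k01] and [k02] are positive, for
    otherwise every atom would have zero moment of [X^2 Y^2]. *)
Lemma represents_psd_remove beta mu : anticommuting beta -> 0 < beta [:: lX; lX; lY; lY] ->
  represents mu beta ->
  exists al ga, [/\ 0 < al, 0 < ga & qpsd (remove_block (quartic_of beta) al ga)].
Proof.
move=> ab mp H; have anti k := represents_anticomm k ab H.
have [f Hf] := choice (fun k => atom_trace_bound (anti k)).
pose S (g : R * R * R * R * R -> R) := \sum_k weight mu k * g (f k).
have wp k : 0 < weight mu k := weight_gt0 k.
have mE : beta [:: lX; lX; lY; lY] = \sum_k weight mu k * atom_seq (atom_of mu k) [:: lX; lX; lY; lY].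
  exact: H.
have nz (g : R * R * R * R * R -> R) : (forall k, 0 <= g (f k)) ->
    (forall k, g (f k) = 0 -> atom_seq (atom_of mu k) [:: lX; lX; lY; lY] = 0) -> 0 < S g.
  move=> g0 gz; have pos k : true -> 0 <= weight mu k * g (f k).
    by move=> _; rewrite mulr_ge0 // ltW.
  rewrite lt_def sumr_ge0 ?andbT; last by move=> k _; apply: pos.
  apply/eqP => /(@psumr_eq0P _ _ _ _ pos) z; move: mp; rewrite mE big1 ?ltxx // => k _.
  have /eqP := z k isT; rewrite mulf_eq0 gt_eqF //= => /eqP /gz ->.
  by rewrite mulr0.
apply: (@exists_psd_remove _ (quartic_of beta) (S (fun c => c.1.1.1.1)) (S (fun c => c.1.1.1.2))
  (S (fun c => c.1.1.2)) (S (fun c => c.1.2)) (S (fun c => c.2))) => //=.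
- apply: nz => k; have := Hf k; case: (f k) => -[[[k00 k01] k02] k11] k22 /=; by case=> -[].
- apply: nz => k; have := Hf k; case: (f k) => -[[[k00 k01] k02] k11] k22 /=; by case=> -[].
- move=> x y z.
  have : 0 <= \sum_k weight mu k * ((f k).1.1.1.1 * x ^+ 2 + 2 * (f k).1.1.1.2 * x * y + 2 * (f k).1.1.2 * x * z
      + (f k).1.2 * y ^+ 2 + 2 * atom_seq (atom_of mu k) [:: lX; lX; lY; lY] * y * z + (f k).2 * z ^+ 2).
    rewrite sumr_ge0 // => k _; apply: mulr_ge0; first exact/ltW.
    by have := Hf k; case: (f k) => -[[[k00 k01] k02] k11] k22 /= [_ [K _]]; apply: K.
  congr (_ <= _); rewrite mE /S !mulr_sumr !mulr_suml -!big_split /=.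
  by apply: eq_bigr => k _; ring.
- move=> g0 g1 g2 g3 g4.
  have -> : qform (quartic_of beta) g0 g1 g2 g3 g4 =
    ((vec7 g0 g1 g2 g3 0 0 g4)^T *m moment_matrix beta *m vec7 g0 g1 g2 g3 0 0 g4) 0 0.
    by rewrite moment_form // subrr expr0n mulr0 addr0.
  rewrite (represents_form _ H).
  apply: le_trans (_ : \sum_k weight mu k * ((f k).1.1.1.1 * g0 ^+ 2 + 2 * (f k).1.1.1.2 * g0 * g3
      + 2 * (f k).1.1.2 * g0 * g4 + (f k).1.2 * g3 ^+ 2
      + 2 * atom_seq (atom_of mu k) [:: lX; lX; lY; lY] * g3 * g4 + (f k).2 * g4 ^+ 2
      + (f k).1.1.1.2 * g1 ^+ 2 + (f k).1.1.2 * g2 ^+ 2) <= _).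
    rewrite le_eqVlt; apply/orP; left; apply/eqP.
    rewrite mE /S !mulr_sumr !mulr_suml -!big_split /=.
    by apply: eq_bigr => k _; ring.
  apply: ler_sum => k _; apply: ler_wpM2l; first exact/ltW.
  by have := Hf k; case: (f k) => -[[[k00 k01] k02] k11] k22 /= [_ [_ K]]; apply: K.
Qed.

End RepresentingMeasures.

(** * Existence of a measure of minimal type *)

Section MinimalMeasures.
Variable R : realType.
Implicit Types (beta : word -> R) (mu : measure R).

(** The last entry is the most significant one: it is minimized first, and the induction treats the
    remaining prefix. *)
Lemma exists_lex_minimal (r : nat) (T : seq nat -> Prop) (n : seq nat) : size n = r -> T n ->
  exists n0, [/\ size n0 = r, T n0 & forall n', size n' = r -> T n' ->
    ~ exists k, (nth 0 n' k < nth 0 n0 k)%N /\ forall j, (k < j)%N -> nth 0%N n' j = nth 0%N n0 j].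
Proof.
elim: r T n => [|r IH] T n.
  move=> /size0nil -> Tn; exists [::]; split=> // n' /size0nil -> _ [k []].
  by rewrite !nth_nil.
move=> sn Tn.
have ex : exists d, `[< exists l, size l = r /\ T (rcons l d) >].
  case/lastP: n sn Tn => [//|l d]; rewrite size_rcons => -[sl] Tn.
  by exists d; apply/asboolP; exists l.
have [d /asboolP[l [sl Tl]] dmin] := ex_minnP ex.
have [l0 [sl0 Tl0 lmin]] := IH (fun l => T (rcons l d)) l sl Tl.
exists (rcons l0 d); rewrite size_rcons sl0; split=> // n'.
case/lastP: n' => [//|l' d']; rewrite size_rcons => -[sl'] Tl' [k [lt eq]].
have dd' : (d <= d')%N by apply: dmin; apply/asboolP; exists l'.
have [kr|kr] := ltnP k r.
  have e : d' = d.
    by have := eq r kr; rewrite !nth_rcons sl' sl0 ltnn eqxx.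
  rewrite e in Tl' eq; apply: (lmin l' sl' Tl'); exists k; split.
    by move: lt; rewrite !nth_rcons sl' sl0 kr.
  move=> j kj; have [jr|jr] := ltnP j r.
    by have := eq j kj; rewrite !nth_rcons sl' sl0 jr.
  by rewrite !nth_default ?sl' ?sl0.
have kr' : (k < r)%N = false by rewrite ltnNge kr.
move: lt; rewrite !nth_rcons sl' sl0 kr'.
by case: eqP => // _; rewrite ltnNge dd'.
Qed.

Lemma has_type_inj mu m n : has_type mu m -> has_type mu n -> m = n.
Proof.
move=> [lm hm] [ln hn]; have e i : nth 0%N m i = nth 0%N n i by rewrite -hm hn.
have key (s t : seq nat) : last 0%N s <> 0%N -> (forall i, nth 0%N s i = nth 0%N t i) ->
    (size s <= size t)%N.
  move=> ls st; rewrite leqNgt; apply/negP => lt; apply: ls.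
  by rewrite (last_nth 0%N); case: s st lt => // a s st lt /=; rewrite [LHS](st (size s)) nth_default.
have sz : size m = size n by apply/eqP; rewrite eqn_leq !key.
by apply: (@eq_from_nth _ 0%N).
Qed.

Lemma has_type_exists mu : exists m, has_type mu m.
Proof.
have [k0 _] : exists k : 'I_(natoms mu), True.
  case: mu => [[|n]] /= a w ai wp ws; last by exists ord0.
  by move: ws; rewrite big_ord0 => /esym/eqP; rewrite oner_eq0.
pose r := \max_(k < natoms mu) atom_size (atom_of mu k).
have [k1 rk] : exists k, r = atom_size (atom_of mu k).
  have [|k e] := @bigop.eq_bigmax _ (fun k : 'I_(natoms mu) => atom_size (atom_of mu k)).
    by rewrite card_ord (leq_ltn_trans _ (ltn_ord k0)).
  by exists k.
have rp : (0 < r)%N by rewrite rk atom_size_gt0.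
have cE i : (i < r)%N || (natoms_of_size mu i.+1 == 0%N).
  rewrite -implyNb -leqNgt; apply/implyP => ri; apply/pred0P => k /=.
  apply/negbTE; rewrite neq_ltn ltnS (leq_trans _ ri) //.
  exact: (@bigop.leq_bigmax _ (fun k => atom_size (atom_of mu k))).
exists (mkseq (fun i => natoms_of_size mu i.+1) r); split=> [|i]; last first.
  have [ir|ri] := ltnP i r; first by rewrite nth_mkseq.
  by rewrite nth_default ?size_mkseq //; apply/eqP; have := cE i; rewrite ltnNge ri.
rewrite -nth_last size_mkseq nth_mkseq ?prednK // => /eqP /pred0P /(_ k1) /=.
by rewrite -rk eqxx.
Qed.

Lemma admits_of_represents beta mu : nc_condition beta -> represents mu beta ->
  admits_nc_measure beta.
Proof.
move=> nc H; have [m0 hm0] := has_type_exists mu.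
pose T m := exists nu, represents nu beta /\ has_type nu m.
have ex : exists r, `[< exists m, size m = r /\ T m >].
  by exists (size m0); apply/asboolP; exists m0; split=> //; exists mu.
have [r /asboolP[m [sm Tm]] rmin] := ex_minnP ex.
have [m1 [sm1 [nu [Hnu tnu]] lmin]] := exists_lex_minimal sm Tm.
exists nu, m1; split=> //.
  split=> // nu' m' n' Hnu' tm tn; rewrite (has_type_inj tm tnu) => -[lt|[es [k [lt eq]]]].
    have : (r <= size n')%N by apply: rmin; apply/asboolP; exists n'; split=> //; exists nu'.
    by rewrite leqNgt -sm1 lt.
  apply: (lmin n'); [by rewrite es | by exists nu' | by exists k].
(* If all atoms had size 1 they would commute, forcing equal moments for [XXYY] and [XYXY]. *)
rewrite ltnNge; apply/negP => s1; apply: nc.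
rewrite !Hnu //; apply: eq_bigr => k _; congr (_ * _).
have : atom_size (atom_of nu k) = 1%N.
  have := atom_size_gt0 (atom_of nu k); case e : (atom_size _) => [//|[//|i]] _.
  have := tnu.2 i.+1; rewrite nth_default; last by apply: leq_trans s1 _.
  by move=> /eqP /pred0P /(_ k) /=; rewrite e eqxx.
case: (atom_of nu k) => t A B /= tp _ _ t1; subst t.
rewrite [A]mx11_scalar [B]mx11_scalar -/(trace_seq _ _ _) -/(trace_seq _ _ _) !trace_seq_point.
by [].
Qed.

End MinimalMeasures.

(** * Measures on the axes *)

Section AxesMeasures.
Variable R : realType.
Implicit Types (beta : word -> R) (mu : measure R) (al ga : R).

Definition monomial (p : R * R) (w : word) : R :=
  p.1 ^+ count (pred1 lX) w * p.2 ^+ count (pred1 lY) w.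

Lemma moment_points_form (gamma : word -> R) (s : seq (R * (R * R))) (v : 'cV[R]_7) :
  (forall w, (size w <= 4)%N -> gamma w = \sum_(a <- s) a.1 * monomial a.2 w) ->
  (v^T *m moment_matrix gamma *m v) 0 0 =
    \sum_(a <- s) a.1 * (\sum_(i < 7) v i 0 * monomial a.2 (nth [::] basis2 i)) ^+ 2.
Proof.
move=> E; rewrite quadratic_formE.
under [RHS]eq_bigr do rewrite expr2 mulr_sumr mulr_sumr.
rewrite [RHS]exchange_big /=; apply: eq_bigr => j _.
under [RHS]eq_bigr do rewrite mulr_suml mulr_sumr.
rewrite [RHS]exchange_big /=; apply: eq_bigr => i _.
rewrite mxE E; last by rewrite size_cat size_rev (leq_add (size_basis2 i) (size_basis2 j)).
rewrite mulr_sumr mulr_suml; apply: eq_bigr => a _.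
by rewrite /monomial !count_cat !count_rev !exprD; ring.
Qed.

Lemma poly2_colE (M : 'M[R]_7) (a : 'I_3 -> 'I_3 -> R) :
  exists2 v : 'cV[R]_7, poly2_col M a = M *m v &
    forall p : R * R, poly2_eval a p.1 p.2 = \sum_(i < 7) v i 0 * monomial p (nth [::] basis2 i).
Proof.
pose i1 : 'I_3 := lift ord0 ord0; pose i2 : 'I_3 := lift ord0 (lift ord0 ord0).
exists (vec7 (a ord0 ord0) (a i1 ord0) (a ord0 i1) (a i2 ord0) (a i1 i1) 0 (a ord0 i2)).
  apply/colP => k; rewrite mxE sum7E !mxE /= /poly2_col.
  rewrite !big_ord_recl !big_ord0 /=; do 3! rewrite big_mkcond !big_ord_recl big_ord0 /=.
  rewrite (@word_colE _ _ [::] (@Ordinal 7 0 isT)) // (@word_colE _ _ [:: lX] (@Ordinal 7 1 isT)) //.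
  rewrite (@word_colE _ _ [:: lY] (@Ordinal 7 2 isT)) // (@word_colE _ _ [:: lX; lX] (@Ordinal 7 3 isT)) //.
  rewrite (@word_colE _ _ [:: lX; lY] (@Ordinal 7 4 isT)) // (@word_colE _ _ [:: lY; lY] (@Ordinal 7 6 isT)) //.
  by rewrite !mxE /i1 /i2; ring.
move=> p; rewrite sum7E !mxE /= /poly2_eval /monomial.
rewrite !big_ord_recl !big_ord0 /=; do 3! rewrite big_mkcond !big_ord_recl big_ord0 /=.
by rewrite /i1 /i2; ring.
Qed.

(** The number of distinct points separates the two sides. It bounds the rank by factoring the
    matrix through evaluations at the points. Each point lies on the variety, because a column
    relation [g] makes the weighted sum of [g^2] vanish. *)
Lemma points_rank_le_card (gamma : word -> R) (s : seq (R * (R * R))) :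
  all (fun a => 0 <= a.1) s ->
  (forall w, (size w <= 4)%N -> gamma w = \sum_(a <- s) a.1 * monomial a.2 w) ->
  rank_le_card_variety (moment_matrix gamma).
Proof.
move=> s0 E; have [s' [us ps E']] := merge_weights s0.
have {}E w : (size w <= 4)%N -> gamma w = \sum_(a <- s') a.1 * monomial a.2 w.
  by move=> /E ->; exact: (E' (fun p => monomial p w)).
pose M := moment_matrix gamma.
have rM : (\rank M <= size s')%N.
  pose z (k : 'I_(size s')) := tnth (in_tuple s') k.
  pose B : 'M[R]_(7, size s') := \matrix_(i, k) ((z k).1 * monomial (z k).2 (nth [::] basis2 i)).
  pose Z : 'M[R]_(size s', 7) := \matrix_(k, j) monomial (z k).2 (nth [::] basis2 j).
  have -> : M = B *m Z; last exact: mulmx_max_rank.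
  apply/matrixP => i j; rewrite !mxE E; last first.
    by rewrite size_cat size_rev (leq_add (size_basis2 i) (size_basis2 j)).
  rewrite big_tnth; apply: eq_bigr => k _; rewrite !mxE /z.
  by rewrite /monomial !count_cat !count_rev !exprD; ring.
have inV a : a \in s' -> variety M a.2.
  move=> as' c; have [v -> ev] := poly2_colE M c => Mv.
  have := moment_points_form v E; rewrite -/M -mulmxA Mv mulmx0 mxE => /esym/eqP.
  rewrite big_seq psumr_eq0 => [/allP /(_ a as')|b bs]; last first.
    by rewrite mulr_ge0 ?sqr_ge0 // ltW // (allP ps b bs).
  rewrite as' /= mulf_eq0 gt_eqF ?(allP ps a as') //= sqrf_eq0 => /eqP.
  by rewrite ev.
rewrite /rank_le_card_variety -/M.
apply: (card_le_trans (B := `I_(size s')%classic)); first by rewrite card_le_II.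
pose f (k : nat) : R * R := nth (0, 0) (map snd s') k.
have inj : {in `I_(size s')%classic &, injective f}.
  move=> k l; rewrite !inE /= => hk hl; rewrite /f => /eqP.
  by rewrite nth_uniq ?size_map // => /eqP.
have := inj_card_eq inj; rewrite card_eq_le => /andP[_ h]; apply: card_le_trans h _.
apply: subset_card_le => _ [k /= hk <-].
rewrite /f (nth_map (0, (0, 0))) //; apply: inV; exact: mem_nth.
Qed.

Lemma axes_seq_points w0 (sx sy : seq (R * R)) w : axes_seq w0 sx sy w =
  \sum_(a <- (w0, (0, 0)) :: [seq (a.1, (a.2, 0)) | a <- sx] ++ [seq (a.1, (0, a.2)) | a <- sy])
    a.1 * monomial a.2 w.
Proof.
rewrite big_cons big_cat !big_map /= /axes_seq !mul1r trace_seq_point; congr (_ + (_ + _)).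
  by apply: eq_bigr => a _; rewrite trace_seq_point.
by apply: eq_bigr => a _; rewrite trace_seq_point.
Qed.

Lemma axes_rep_psd beta al ga : anticommuting beta -> 0 < al -> 0 < ga ->
  axes_rep (remove_block (quartic_of beta) al ga) ->
  let M := moment_matrix (block_removed beta al ga) in
  [/\ psd M, cm_moment_matrix M & rank_le_card_variety M].
Proof.
move=> ab ap gp [w0 [sx [sy rep]]] M.
have E := axes_rep_seq ab ap gp rep; case: rep => -[w00 ax ay] _.
have ar := block_removed_anticommuting al ga ab.
have all0 : all (fun a : R * (R * R) => 0 <= a.1) ((w0, (0, 0)) ::
    [seq (a.1, (a.2, 0)) | a <- sx] ++ [seq (a.1, (0, a.2)) | a <- sy]).
  rewrite /= w00 all_cat !all_map /=; apply/andP; split.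
    exact: ax.
  exact: ay.
have {}E w : (size w <= 4)%N -> block_removed beta al ga w = \sum_(a <- (w0, (0, 0)) ::
    [seq (a.1, (a.2, 0)) | a <- sx] ++ [seq (a.1, (0, a.2)) | a <- sy]) a.1 * monomial a.2 w.
  by move=> /E ->; rewrite axes_seq_points.
have z : block_removed beta al ga [:: lX; lX; lY; lY] = 0.
  by have := f_equal (@cXXYY R) (quartic_block_removed beta ap gp).
split.
- split=> [|v]; first by apply: moment_matrix_sym; case: ar.
  rewrite (moment_points_form v E) big_seq sumr_ge0 // => a sa.
  by rewrite mulr_ge0 ?sqr_ge0 // (allP all0 a sa).
- exists (block_removed beta al ga); split=> //; split; first by case: ar.
  by rewrite /cm_condition; case: ar => _ [_ ->]; rewrite z oppr0.
- exact: points_rank_le_card all0 E.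
Qed.

(** After the subtraction, the entries for [XXYY] and [YXYX] are opposite by anticommutation and
    equal by the commutative condition, hence zero, which determines [xi]. *)
Lemma cm_removal_weight beta al ga xi : anticommuting beta -> 0 < al -> 0 < ga ->
  cm_moment_matrix (moment_matrix beta - xi *: pair_moment_matrix (block_X al) (block_Y ga)) ->
  xi = beta [:: lX; lX; lY; lY] * al * ga.
Proof.
move=> ab ap gp [gamma [[[tr _] cm] /matrixP e]].
have e36 := e (@Ordinal 7 3 isT) (@Ordinal 7 6 isT).
have e45 := e (@Ordinal 7 4 isT) (@Ordinal 7 5 isT).
have t : gamma [:: lY; lX; lY; lX] = gamma [:: lX; lY; lX; lY] by apply: tr => //; exists 1%N.
have v1 : ntrace (word_eval (block_X al) (block_Y ga) [:: lX; lX; lY; lY]) = al^-1 * ga^-1.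
  by have := f_equal (@cXXYY R) (block_quartic ap gp).
have v2 : ntrace (word_eval (block_X al) (block_Y ga) [:: lY; lX; lY; lX]) = - (al^-1 * ga^-1).
  rewrite -v1.
  have := anticommuting_canonical (w := [:: lY; lX; lY; lX]) (block_seq_anticommuting al ga).
  by move=> /(_ isT).
have v3 : beta [:: lY; lX; lY; lX] = - beta [:: lX; lX; lY; lY].
  by have /(_ isT) := anticommuting_canonical (w := [:: lY; lX; lY; lX]) ab.
move: e36 e45; rewrite !mxE /= t -cm v1 v2 v3 => h1 h2.
have : (al * ga) * (beta [:: lX; lX; lY; lY] - xi * (al^-1 * ga^-1)) = 0.
  by apply/eqP; rewrite mulf_eq0; apply/orP; right; apply/eqP; move: (al^-1 * ga^-1) h1 h2 => k; lra.
have -> : (al * ga) * (beta [:: lX; lX; lY; lY] - xi * (al^-1 * ga^-1)) =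
  beta [:: lX; lX; lY; lY] * al * ga - xi by field; rewrite !gt_eqF.
lra.
Qed.

End AxesMeasures.

(** * Vanishing odd moments *)

Section SymmetricCase.
Variable R : realType.
Implicit Types (beta : word -> R).

Lemma type31_of_axes_rep beta al ga (w0 : R) sx sy : anticommuting beta -> normalized beta ->
  0 < beta [:: lX; lX; lY; lY] -> 0 < al -> 0 < ga -> 0 < w0 ->
  axes_rep_by (remove_block (quartic_of beta) al ga) w0 sx sy ->
  all (fun a => 0 < a.1) (sx ++ sy) -> size (sx ++ sy) = 2%N ->
  uniq ((0, 0) :: [seq (a.2, 0) | a <- sx] ++ [seq (0, a.2) | a <- sy]) ->
  has_nc_measure_of_type beta [:: 3; 1]%N.
Proof.
move=> ab b1 mp ap gp w0p rep ps s2 us.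
have E := axes_rep_atoms ab ap gp rep.
set s := block_axes_atoms _ _ _ _ _ _ in E.
have us' : uniq (map snd s).
  (* Size and first moments already separate the block and the points, which avoids comparing
     matrices of different sizes. *)
  pose key (t : {classic atom R}) : nat * (R * R) :=
    (atom_size (t : atom R), (atom_seq t [:: lX], atom_seq t [:: lY])).
  have kp x y : key (point_atom x y) = (1%N, (x, y)).
    rewrite /key /atom_seq; congr (_, (_, _)).
      by rewrite trace_seq_point /= expr1 expr0 mulr1.
    by rewrite trace_seq_point /= expr1 expr0 mul1r.
  apply: (@map_uniq _ _ key); rewrite /s /block_axes_atoms /= map_cat map_cat -!map_comp.
  have -> : forall t : seq (R * R), map (key \o (snd \o (fun a => (a.1, point_atom a.2 0 : {classic atom R})))) t
      = map (pair 1%N) (map (fun a => (a.2, 0)) t).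
    by move=> t; rewrite -map_comp; apply: eq_map => a /=; rewrite kp.
  have -> : forall t : seq (R * R), map (key \o (snd \o (fun a => (a.1, point_atom 0 a.2 : {classic atom R})))) t
      = map (pair 1%N) (map (fun a => (0, a.2)) t).
    by move=> t; rewrite -map_comp; apply: eq_map => a /=; rewrite kp.
  rewrite kp -map_cat -[(1%N, (0, 0)) :: _]/(map (pair 1%N) ((0, 0) :: _)).
  move: us; rewrite -(map_inj_uniq (f := pair 1%N)) => [us|? ? []//].
  by rewrite -cons_uniq cons_uniq us andbT; apply/mapP => -[? _].
have ps' : all (fun a => 0 < a.1) s.
  rewrite /s /= w0p !mulr_gt0 //= all_cat !all_map; move: ps; rewrite all_cat.
  by [].
have [|mu [Hmu cmu]] := measure_of_seq us' ps'.
  have := E [::] isT; rewrite b1 => ->.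
  by apply: eq_bigr => a _; rewrite atom_seq_nil mulr1.
exists mu; split; first by move=> w sw; rewrite (E w sw) -(Hmu (fun t => atom_seq t w)).
split=> // i; rewrite cmu /s /= count_cat !count_map.
have c (p : pred (R * R)) (k : bool) : (forall a, p a = k) -> (count p sx + count p sy = k * 2)%N.
  move=> pk; rewrite -count_cat -s2 (eq_count (a2 := fun _ => k)) //.
  by case: k {pk}; rewrite ?count_predT ?count_pred0 ?mul1n ?mul0n.
case: i => [|[|i]].
- by rewrite (c _ true).
- by rewrite (c _ false).
- by rewrite (c _ false) //= nth_nil.
Qed.

Lemma symmetric_type31 beta : anticommuting beta -> normalized beta ->
  0 < beta [:: lX; lX; lY; lY] -> qpd (quartic_of beta) ->
  [/\ beta [:: lX] = 0, beta [:: lY] = 0, beta [:: lX; lX; lX] = 0 & beta [:: lY; lY; lY] = 0] ->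
  has_nc_measure_of_type beta [:: 3; 1]%N.
Proof.
move=> ab b1 mp pd [z1 z2 z3 z4].
have A2 := qpd_cXX_gt0 pd.
have C2 : 0 < cYY (quartic_of beta) := qpd_cXX_gt0 (qpd_swap pd).
have pair_moments (w u : R) : let s := [:: (w / 2, u); (w / 2, - u)] in
    [/\ pmoment s 0 = w, pmoment s 1 = 0, pmoment s 2 = w * u ^+ 2, pmoment s 3 = 0
      & pmoment s 4 = w * u ^+ 4].
  by rewrite /pmoment !big_cons !big_nil /=; split; field.
have nil_moments k : pmoment ([::] : seq (R * R)) k = 0 by rewrite /pmoment big_nil.
have [c|c] := symmetric_removal_or_swap pd mp A2 C2.
- have [al [ga [w0 [w [u [[ap gp w0p wp up] [e0 e2 e4 f2 f4]]]]]]] :=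
    symmetric_removal pd mp C2 z1 z2 z3 z4 c.
  have [m0 m1 m2 m3 m4] := pair_moments w u.
  apply: (@type31_of_axes_rep _ al ga w0 [:: (w / 2, u); (w / 2, - u)] [::]) => //.
  + split; first by rewrite /= !divr_ge0 ?ltW.
    rewrite m0 m1 m2 m3 m4 !nil_moments e0 e2 e4 f2 f4 addr0; split=> //; split=> //.
  + by rewrite /= divr_gt0.
  + rewrite /= !inE !xpair_eqE !eqxx !andbT; apply/andP; split; last by rewrite -subr_eq0; lra.
    by rewrite eq_sym (gt_eqF up) eq_sym oppr_eq0 (gt_eqF up).
- have [al [ga [w0 [w [u [[ap gp w0p wp up] [e0 e2 e4 f2 f4]]]]]]] :=
    symmetric_removal (qpd_swap pd) mp A2 z2 z1 z4 z3 c.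
  have [m0 m1 m2 m3 m4] := pair_moments w u.
  move: e0 e2 e4 f2 f4; rewrite remove_block_swap => e0 e2 e4 f2 f4.
  apply: (@type31_of_axes_rep _ ga al w0 [::] [:: (w / 2, u); (w / 2, - u)]) => //.
  + split; first by rewrite /= !divr_ge0 ?ltW.
    move: e0 e2 e4 f2 f4 => /= e0 e2 e4 f2 f4.
    rewrite m0 m1 m2 m3 m4 !nil_moments /= e0 e2 e4 f2 f4 addr0; split=> //; split=> //.
  + by rewrite /= divr_gt0.
  + rewrite /= !inE !xpair_eqE !eqxx /=; apply/andP; split; last by rewrite -subr_eq0; lra.
    by rewrite eq_sym (gt_eqF up) eq_sym oppr_eq0 (gt_eqF up).
Qed.

End SymmetricCase.

Theorem theorem7p8 (R : realType) (beta : word -> R)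
  (beta_nc : nc_sequence beta)
  (beta_normalized : normalized beta)
  (rank_M2 : \rank (moment_matrix beta) = 6%N)
  (XY_YX : word_col (moment_matrix beta) [:: lX; lY]
           + word_col (moment_matrix beta) [:: lY; lX] = 0) :
  let M2 := moment_matrix beta in
  let cond1 := [/\ beta [:: lX] = 0, beta [:: lY] = 0,
                   beta [:: lX; lX; lX] = 0 & beta [:: lY; lY; lY] = 0] in
  let cond2 := exists a1 a3 xi : R,
    let X := mat2 (Num.sqrt a1) 0 0 (- Num.sqrt a1) in
    let Y := mat2 0 (Num.sqrt a3) (Num.sqrt a3) 0 in
    let M := M2 - xi *: pair_moment_matrix X Y in
    [/\ 0 < a1, 0 < a3 & smallest_rank_drop M2 (pair_moment_matrix X Y) xi] /\
    [/\ psd M, cm_moment_matrix M & rank_le_card_variety M] in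
  (admits_nc_measure beta <-> psd M2 /\ (cond1 \/ cond2)) /\
  (psd M2 -> cond1 ->
     has_nc_measure_of_type beta [:: 2; 1]%N \/ has_nc_measure_of_type beta [:: 3; 1]%N).
Proof.
move=> M2 cond1 cond2; have [tb nc] := beta_nc.
have ab := relation_anticommuting tb XY_YX.
have type31 : psd M2 -> cond1 -> has_nc_measure_of_type beta [:: 3; 1]%N.
  move=> pM c1; have [mp pd] := rank6_qpd ab nc pM rank_M2.
  exact: symmetric_type31.
split; last by move=> pM c1; right; apply: type31.
split=> [[mu [m [[rep _] _ _]]]|[pM c]].
  have pM := represents_psd tb rep; have [mp pd] := rank6_qpd ab nc pM rank_M2.
  split=> //; right.
  have [al0 [ga0 [ap0 gp0 H0]]] := represents_psd_remove ab mp rep.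
  (* The block extracted from the measure may leave mass at infinity. The perturbed one leaves a
     measure carried by points of the axes, and the rank bound comes from these points. *)
  have [al [ga [ap gp H]]] := psd_remove_axes_rep pd mp ap0 gp0 H0.
  have [pB cB rB] := axes_rep_psd ab ap gp H.
  exists al^-1, ga^-1, (beta [:: lX; lX; lY; lY] * al * ga) => X Y M.
  have -> : M = moment_matrix (block_removed beta al ga) by rewrite moment_block_removed.
  split=> //; split; rewrite ?invr_gt0 //.
  exact: block_smallest_rank_drop.
have [mp pd] := rank6_qpd ab nc pM rank_M2.
case: c => [c1|[a1 [a3 [xi [[a1p a3p _] [pB cB _]]]]]].
  by have [mu [rep _]] := type31 pM c1; apply: admits_of_represents nc rep.
pose al := a1^-1; pose ga := a3^-1.
have ap : 0 < al by rewrite invr_gt0.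
have gp : 0 < ga by rewrite invr_gt0.
have XE : mat2 (Num.sqrt a1) 0 0 (- Num.sqrt a1) = block_X al by rewrite /block_X invrK.
have YE : mat2 0 (Num.sqrt a3) (Num.sqrt a3) 0 = block_Y ga by rewrite /block_Y invrK.
(* The weight of the block is forced, so [M] is the block-removed matrix; its positivity then leads
   to a possibly different block with solvable axis problems. *)
rewrite XE YE in pB cB; have xiE := cm_removal_weight ab ap gp cB.
rewrite xiE -moment_block_removed in pB.
have [H _] := (psd_momentP (block_removed_anticommuting al ga ab)).1 pB.
rewrite quartic_block_removed // in H.
have [al' [ga' [ap' gp' H']]] := psd_remove_axes_rep pd mp ap gp H.
have [mu rep] := axes_rep_represents ab beta_normalized mp ap' gp' H'.
exact: admits_of_represents nc rep.
Qed.
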